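(* Let $n\ge 2$ and $1\le m\le n$ be integers. The expected number $\mu(m,n)$ of bit comparisons required by Quickselect to find the rank-$m$ key among $n$ keys is given by the finite sum $$\mu(m,n)=\mu_1(m,n)+\mu_2(m,n)+\mu_3(m,n),\qquad \mu_q(m,n)=\sum_{a=1}^{n-1}C_7^{(q)}(a)\,(1-2^{-a})^{-2}\quad(q=1,2,3),$$ where the coefficients $C_7^{(q)}(a)$ (depending on $m$ and $n$) are defined by $$C_7^{(q)}(a):=\sum_{f=0}^{n-2}\ \sum_{h=\max(0,\,a-f-1)}^{n-f-2}\ \sum_{j=\max(1,\,f+h+2-a)}^{f+h+1}a_{j,\;a+j-(f+h+2)}\;C_3^{(q)}(f,h)\;C_4(f,h,j),$$ with $a_{j,r}$, $C_3^{(q)}$ and $C_4$ the explicit finite expressions defined in the context.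
   Context: Quickselect finds the rank-$m$ (i.e. $m$-th smallest) key among $n$ distinct keys as follows: it selects a pivot uniformly at random from the current set of keys and compares every other key in the set with the pivot, thereby determining the rank $k$ of the pivot. If $k=m$ it returns the pivot; if $k>m$ it recursively finds the rank-$m$ key in the set of keys smaller than the pivot; if $k<m$ it recursively finds the rank-$(m-k)$ key in the set of keys larger than the pivot. All pivot choices are made using randomness independent of the key values. Keys are $n$ independent uniform random variables on $(0,1)$, represented by their binary expansions. Comparing two keys $s\ne t$ costs $\beta(s,t)$ bit comparisons, where $\beta(s,t)$ is the index of the first bit at which the binary expansions of $s$ and $t$ differ. $\mu(m,n)$ is the expected total number of bit comparisons (sum of $\beta$ over all key comparisons made) when Quickselect finds the rank-$m$ key among $n$ keys. The quantities $\mu_q(m,n)$ are the contributions $$\mu_q(m,n):=\int_0^1\!\int_s^1\beta(s,t)\,P_q(s,t,m,n)\,dt\,ds,\qquad P_q(s,t,m,n):=\sum_{1\le i<j\le n}C_1^{(q)}(i,j)\,s^{i-1}(t-s)^{j-i-1}(1-t)^{n-j},$$ where, with $I\{\cdot\}$ the indicator function and $\binom{n}{i-1,1,j-i-1,1,n-j}=\frac{n!}{(i-1)!\,(j-i-1)!\,(n-j)!}$, $$C_1^{(1)}(i,j):=I\{1\le m\le i<j\le n\}\frac{2}{j-m+1}\binom{n}{i-1,1,j-i-1,1,n-j},$$ $$C_1^{(2)}(i,j):=I\{1\le i<m<j\le n\}\frac{2}{j-i+1}\binom{n}{i-1,1,j-i-1,1,n-j},$$ $$C_1^{(3)}(i,j):=I\{1\le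 i<j\le m\le n\}\frac{2}{m-i+1}\binom{n}{i-1,1,j-i-1,1,n-j}.$$ Further define $$C_2^{(q)}(f,h):=\sum_{i=1}^{f+1}\sum_{j=f+2}^{f+h+2}C_1^{(q)}(i,j)\binom{j-i-1}{f-i+1}\binom{n-j}{h-j+f+2}(-1)^{h-i-j+1},$$ $$C_3^{(q)}(f,h):=\frac{1}{(h+1)(f+1)}C_2^{(q)}(f,h),$$ $$C_4(f,h,j):=(-1)^{f+h-j+1}\left(\tfrac12\right)^{h-j+2}\sum_{j'=\max(0,\,j-1-h)}^{\min(j-1,\,f)}\binom{f+1}{j'}\binom{h+1}{j-1-j'}\left[1-\left(\tfrac12\right)^{f+1-j'}\right]\left(\tfrac12\right)^{j'},$$ $$a_{j,r}:=\begin{cases}\frac{B_r}{r}\binom{j-1}{r-1}& r\ge 2,\\ \frac12 & r=1,\\ \frac1j & r=0,\end{cases}$$ where $B_r$ is the $r$-th Bernoulli number. Empty sums are $0$. *)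

(* Defs.v *)
From HB Require Import structures.
From mathcomp Require Import all_boot all_order all_algebra.
From mathcomp Require Import all_classical all_reals all_analysis.

Set Implicit Arguments.
Unset Strict Implicit.
Unset Printing Implicit Defensive.

Import Order.TTheory GRing.Theory Num.Theory.
Import numFieldNormedType.Exports.

Local Open Scope classical_set_scope.
Local Open Scope ring_scope.

Section Quickselect.
Variable R : realType.

(* [bit k x] is the k-th bit (k >= 1) of the fractional part of x >= 0; dyadic
   rationals get their terminating expansion. *)
Definition bit (k : nat) (x : R) : bool := odd (Num.truncn (2 ^+ k * x)).

(* Bits are numbered from 1, hence the successors. The value 0 when all bits
   agree is a junk value: it is not reached for distinct keys in (0,1). *)
Definition beta (s t : R) : nat :=
  if pselect (exists k, bit k.+1 s != bit k.+1 t) is left e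
  then (ex_minn e).+1 else 0.

(* Number of bit comparisons made by one run of Quickselect on a list of
   distinct keys. [u c] is the position of the pivot in the current list when
   that list has c elements. The lists of successive calls are strictly
   shorter, so every [u c] is used at most once in a run. Each call consumes
   one unit of the first argument [d], so d = size s suffices. *)
Fixpoint qs_cost_rec (d : nat) (u : nat -> nat) (m : nat) (s : seq R) : nat :=
  if d is d'.+1 then
    if s is [::] then 0 else
    let pivot := nth 0 s (u (size s)) in
    let smaller := [seq y <- s | y < pivot] in
    let larger := [seq y <- s | pivot < y] in
    let k := (size smaller).+1 in
    (\sum_(y <- s | y != pivot) beta y pivot +
     (if k == m then 0
      else if (m < k)%N then qs_cost_rec d' u m smaller
      else qs_cost_rec d' u (m - k) larger))%N
  else 0.

Definition qs_cost (u : nat -> nat) (m : nat) (s : seq R) : nat :=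
  qs_cost_rec (size s) u m s.

(* Mutual independence of a finite family of classes of events. *)
Definition mutually_independent d (T : measurableType d) (P : probability T R)
    (I : finType) (G : I -> set (set T)) : Prop :=
  forall (J : {set I}) (E : I -> set T), (forall i, i \in J -> G i (E i)) ->
  P (\bigcap_(i in [set` J]) E i) = (\prod_(i in J) P (E i))%E.

(* The sigma-algebras generated by the keys X 0, ..., X (n-1) and by the pivot
   choices U 1, ..., U n. *)
Definition key_pivot_events d (T : measurableType d) (P : probability T R)
    (n : nat) (X : 'I_n -> {RV P >-> R}) (U : nat -> {RV P >-> nat})
    (i : 'I_n + 'I_n) : set (set T) :=
  match i with
  | inl i => g_sigma_algebra_preimage (X i)
  | inr c => g_sigma_algebra_preimage (U c.+1)
  end.

Section Coefficients.
Variables (q m n : nat).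

(* The truncated subtractions below are exact whenever the indicator is 1. *)
Definition multinom (i j : nat) : R :=
  n`!%N%:R / (i.-1`!%N%:R * (j - i).-1`!%N%:R * (n - j)`!%N%:R).

Definition C1 (i j : nat) : R :=
  match q with
  | 1%N => ((1 <= m <= i) && (i < j <= n))%N%:R *
           (2 / (j - m + 1)%N%:R) * multinom i j
  | 2%N => ((1 <= i < m) && (m < j <= n))%N%:R *
           (2 / (j - i + 1)%N%:R) * multinom i j
  | 3%N => ((1 <= i < j) && (j <= m <= n))%N%:R *
           (2 / (m - i + 1)%N%:R) * multinom i j
  | _ => 0
  end.

Definition Pq (s t : R) : R :=
  \sum_(1 <= i < n.+1) \sum_(i.+1 <= j < n.+1)
    C1 i j * s ^+ i.-1 * (t - s) ^+ (j - i).-1 * (1 - t) ^+ (n - j).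

Definition mu_q : \bar R :=
  (\int[lebesgue_measure]_(s in `]0%R, 1%R[)
     \int[lebesgue_measure]_(t in `]s, 1%R[) ((beta s t)%:R * Pq s t)%:E)%E.

(* Signed exponents are taken in int, as they may be negative. *)
Definition C2 (f h : nat) : R :=
  \sum_(1 <= i < f.+2) \sum_(f.+2 <= j < (f + h + 3)%N)
    C1 i j * 'C((j - i).-1, f.+1 - i)%:R * 'C(n - j, h + f + 2 - j)%:R *
    (-1) ^ (h%:Z - i%:Z - j%:Z + 1).

Definition C3 (f h : nat) : R := ((h.+1)%:R * (f.+1)%:R)^-1 * C2 f h.

End Coefficients.

Definition C4 (f h j : nat) : R :=
  (-1) ^ (f%:Z + h%:Z - j%:Z + 1) * 2^-1 ^ (h%:Z - j%:Z + 2) *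
  \sum_((j.-1 - h)%N <= j' < (minn j.-1 f).+1)
    'C(f.+1, j')%:R * 'C(h.+1, j.-1 - j')%:R *
    (1 - 2^-1 ^+ (f.+1 - j')) * 2^-1 ^+ j'.

(* [:: B_0; ...; B_(r-1)], by (r+1) B_r = [r = 0] - \sum_(k < r) C(r+1,k) B_k *)
Fixpoint bernoulli_seq (r : nat) : seq R :=
  if r is r'.+1 then
    let s := bernoulli_seq r' in
    rcons s (((r' == 0)%:R - \sum_(k < r') 'C(r'.+1, k)%:R * s`_k) / r'.+1%:R)
  else [::].

Definition bernoulli (r : nat) : R := (bernoulli_seq r.+1)`_r.

Definition a_coef (j r : nat) : R :=
  match r with
  | 0%N => j%:R^-1
  | 1%N => 2^-1
  | _ => bernoulli r / r%:R * 'C(j.-1, r.-1)%:R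
  end.

(* Truncated subtraction renders the lower bound max(0, a-f-1) of h; it is
   exact in the second index of [a_coef]. *)
Definition C7 (q m n a : nat) : R :=
  \sum_(0 <= f < n.-1) \sum_((a - f.+1)%N <= h < (n - f.+1)%N)
    \sum_(maxn 1 (f + h + 2 - a)%N <= j < (f + h + 2)%N)
      a_coef j (a + j - (f + h + 2))%N * C3 q m n f h * C4 f h j.

End Quickselect.
Arguments mu_q : clear implicits.
Arguments C7 : clear implicits.
Arguments bernoulli : clear implicits.

Lemma size_bernoulli_seq (R : realType) r : size (bernoulli_seq R r) = r.
Proof. by elim: r => //= r IH; rewrite size_rcons IH. Qed.

Lemma nth_bernoulli_seq (R : realType) r k :
  (k < r)%N -> (bernoulli_seq R r)`_k = bernoulli R k.
Proof.
elim: r => // r IH; rewrite ltnS leq_eqVlt => /orP[/eqP ->//|kr].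
by rewrite /= nth_rcons size_bernoulli_seq kr IH.
Qed.

(* The defining recurrence of the Bernoulli numbers. *)
Lemma bernoulli_rec (R : realType) r :
  \sum_(k < r.+1) 'C(r.+1, k)%:R * bernoulli R k = (r == 0)%:R.
Proof.
rewrite big_ord_recr /= {2}/bernoulli /= nth_rcons size_bernoulli_seq ltnn eqxx.
rewrite binSn mulrCA divff ?pnatr_eq0// mulr1 addrC.
by under eq_bigr do rewrite nth_bernoulli_seq//; rewrite subrK.
Qed.

(* Main.v *)
(* For fixed keys and uniform pivot positions, the keys of ranks i < j are compared
   with probability 2 / (max(j, m) - min(i, m) + 1). For independent uniform keys, two
   of which have the values s < t, the numbers of the others below s, between s and t,
   and above t are multinomial; averaging the comparison probability over them gives
   P_1 + P_2 + P_3, up to the number of ordered pairs of keys.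

   For the closed form, beta(s, t) = k + 1 exactly when s and t lie in the left and the
   right half of a common dyadic cell [l / 2^k, (l + 1) / 2^k[. The integral of P_q over
   such a product of halves is a polynomial in l + 1; Faulhaber's formula turns its sum
   over l < 2^k into a combination of the powers (2^-a)^k with coefficients C_7(a), and
   the sum over k of (k + 1) x^k is (1 - x)^-2. *)

Require Import Defs.
From HB Require Import structures.
From mathcomp Require Import all_boot all_order all_algebra.
From mathcomp Require Import all_classical all_reals all_analysis.
From mathcomp Require Import measurable_realfun zify ring lra.

Set Implicit Arguments.
Unset Strict Implicit.
Unset Printing Implicit Defensive.

Import Order.TTheory GRing.Theory Num.Theory.
Import numFieldNormedType.Exports.

Local Open Scope classical_set_scope.
Local Open Scope ring_scope.

(** On the integral side everything is nonnegative, so series and integrals are exchanged in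
    [\bar R] by monotone convergence and Tonelli, without integrability conditions. Signs appear
    only in [C2], [C4] and [C7], which enter as finite real sums after each cell has been integrated
    exactly; finiteness of the mean is an outcome.

    On the probabilistic side, mutual independence of families of events has to become an iterated
    integral. For this [T] is viewed with the sigma-algebra of one block of keys and pivot choices,
    the identity map being the random variable; disjoint blocks are independent by a pi-system
    argument, so their joint law is a product measure. The random pivots are replaced by a finite
    average over tables [g] of positions, for which the mean cost at fixed distinct keys is a finite
    identity. Keys are distinct only almost everywhere.

    Ranks depend on all keys at once. The comparison weight is therefore rewritten as a sum over the
    possible sets of other keys below, between and above two levels [s < t]; the other keys are
    integrated at fixed levels, the levels last. *)

(** * Binary digits and dyadic cells *)

Section Dyadic.
Variable R : realType.
Implicit Types (s t x : R).

(** The first [k] bits of [x] read as a binary number, for [x] in [[0, 1[]; its parity is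
    [bit k x]. *)
Definition dig k x : nat := Num.truncn (2 ^+ k * x).

Lemma digS k x : 0 <= x -> dig k.+1 x = ((dig k x).*2 + bit k.+1 x)%N.
Proof.
move=> x0; rewrite /bit -/(dig k.+1 x) addnC.
rewrite -[LHS]odd_double_half; congr (_ + _.*2)%N.
have y0 : 0 <= 2 ^+ k * x by rewrite mulr_ge0// exprn_ge0.
rewrite /dig exprS -mulrA.
move: (2 ^+ k * x) y0 => y y0.
have /andP[a1 a2] := truncn_itv y0.
have [b|b] := leP (Num.truncn y).*2.+1%:R (2 * y).
  rewrite (@truncn_def _ (2 * y) (Num.truncn y).*2.+1) ?b/= ?uphalf_double//.
  by move: a2; rewrite -!muln2 -!natr1 natrM; lra.
rewrite (@truncn_def _ (2 * y) (Num.truncn y).*2) ?b/= ?doubleK//.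
by rewrite -!muln2 natrM; move: a1; lra.
Qed.

Lemma dig0 x : x < 1 -> dig 0 x = 0%N.
Proof. by move=> x1; apply/truncn0Pn; rewrite mul1r -ltNge. Qed.

Lemma dig_bits_eq k s t : 0 <= s < 1 -> 0 <= t < 1 ->
  dig k s = dig k t <-> (forall j, (j < k)%N -> bit j.+1 s = bit j.+1 t).
Proof.
move=> /andP[s0 s1] /andP[t0 t1]; elim: k => [|k IH]; first by rewrite !dig0.
rewrite !digS//; split.
  move=> E; have Eb : bit k.+1 s = bit k.+1 t.
    by move/(congr1 odd) : E; rewrite !oddD !odd_double/= !oddb.
  move=> j; rewrite ltnS leq_eqVlt => /orP[/eqP ->//|]; move: j; apply/IH.
  by apply: double_inj; apply/eqP; rewrite -(eqn_add2r (bit k.+1 s)) {2}Eb E.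
move=> H; rewrite (H k)//; congr (_.*2 + _)%N; apply/IH => j jk.
by apply: H; rewrite ltnS ltnW.
Qed.

Lemma beta_eq k s t : 0 <= s < 1 -> 0 <= t < 1 ->
  dig k s = dig k t -> dig k.+1 s != dig k.+1 t -> beta s t = k.+1.
Proof.
move=> hs ht /(dig_bits_eq k hs ht) Ek /eqP Nk.
have bk : bit k.+1 s != bit k.+1 t.
  apply/eqP => b; apply: Nk; apply/dig_bits_eq => // j.
  by rewrite ltnS leq_eqVlt => /orP[/eqP ->//|]; exact: Ek.
rewrite /beta; case: pselect => [e|[]]; last by exists k.
case: ex_minnP => j bj jmin; congr _.+1; apply/eqP; rewrite eqn_leq jmin//=.
by rewrite leqNgt; apply/negP => /Ek b; move: bj; rewrite b eqxx.
Qed.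

Lemma beta_sym s t : beta s t = beta t s.
Proof.
rewrite /beta; case: pselect => [e|e]; case: pselect => [e'|e'] //.
- congr _.+1; apply/eqP; case: ex_minnP => i bi imin; case: ex_minnP => j bj jmin.
  by rewrite eqn_leq imin 1?eq_sym// jmin// eq_sym.
- by case: e' => //; case: e => k; rewrite eq_sym; exists k.
- by case: e => //; case: e' => k; rewrite eq_sym; exists k.
Qed.

Definition left_half k l : interval R := `[l%:R / 2 ^+ k, (l%:R + 2^-1) / 2 ^+ k[.
Definition right_half k l : interval R := `[(l%:R + 2^-1) / 2 ^+ k, l.+1%:R / 2 ^+ k[.
Definition halves k l s t : bool := (s \in left_half k l) && (t \in right_half k l).

(** The halves of cell [l] at level [k] are the cells [l.*2] and [l.*2.+1] at level [k.+1]. The sign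
    condition matters: [Num.truncn] sends negative numbers to 0, the digit of the leftmost cell. *)
Lemma left_halfE k l s : 0 <= s -> (s \in left_half k l) = (dig k.+1 s == l.*2).
Proof.
move=> s0; have K : 0 < 2 ^+ k :> R by rewrite exprn_gt0.
rewrite /dig truncn_eq ?mulr_ge0 ?exprn_ge0// /left_half in_itv/=.
rewrite ler_pdivrMr// ltr_pdivlMr// -muln2 -[(l * 2).+1%:R]natr1 natrM exprS.
by apply/idP/idP => /andP[a b]; apply/andP; split; move: a b; lra.
Qed.

Lemma right_halfE k l s : 0 <= s -> (s \in right_half k l) = (dig k.+1 s == l.*2.+1).
Proof.
move=> s0; have K : 0 < 2 ^+ k :> R by rewrite exprn_gt0.
rewrite /dig truncn_eq ?mulr_ge0 ?exprn_ge0// /right_half in_itv/=.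
rewrite ler_pdivrMr// ltr_pdivlMr// -muln2 -[(l * 2).+2%:R]natr1 -[(l * 2).+1%:R]natr1 -[l.+1%:R]natr1 natrM exprS.
by apply/idP/idP => /andP[a b]; apply/andP; split; move: a b; lra.
Qed.

Lemma halves_itv k l s t : (l < 2 ^ k)%N -> halves k l s t -> 0 <= s /\ s < t /\ t < 1.
Proof.
move=> lk; have K : 0 < 2 ^+ k :> R by rewrite exprn_gt0.
rewrite /halves /left_half /right_half !in_itv/= => /andP[/andP[a b] /andP[c d]].
split; first by apply: le_trans a; rewrite divr_ge0 ?ler0n// ltW.
split; first exact: lt_le_trans c.
apply: lt_le_trans d _; rewrite ler_pdivrMr// mul1r -natrX ler_nat//.
Qed.

Lemma halves_beta k l s t : (l < 2 ^ k)%N -> halves k l s t -> beta s t = k.+1.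
Proof.
move=> lk H; have [s0 [st t1]] := halves_itv lk H.
have t0 : 0 <= t by apply: le_trans (ltW st).
have s1 : s < 1 by apply: lt_trans t1.
move: H; rewrite /halves left_halfE// right_halfE// => /andP[/eqP a /eqP b].
apply: beta_eq; rewrite ?s0 ?t0//; last by rewrite a b; lia.
move: a b; rewrite !digS//; case: bit; case: bit; lia.
Qed.

Lemma dig_lt k x : 0 <= x < 1 -> (dig k x < 2 ^ k)%N.
Proof.
move=> /andP[x0 x1]; rewrite /dig truncn_lt_nat ?mulr_ge0 ?exprn_ge0//.
by rewrite natrX gtr_pMr// exprn_gt0.
Qed.

Lemma dig_mono k s t : s <= t -> (dig k s <= dig k t)%N.
Proof. by move=> st; apply: le_truncn; rewrite ler_pM2l// exprn_gt0. Qed.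

Lemma halves_ex s t : 0 <= s -> s < t -> t < 1 ->
  exists k l, (l < 2 ^ k)%N /\ halves k l s t.
Proof.
move=> s0 st t1.
have t0 : 0 <= t by apply: le_trans (ltW st).
have s1 : s < 1 by apply: lt_trans t1.
have : exists k, dig k s != dig k t.
  (* Since [2 ^ N > N > 1 / (t - s)], the scaled points are more than 1 apart and cannot share a
     truncation. *)
  pose N := (Num.truncn (t - s)^-1).+1.
  have HN : 1 < 2 ^+ N * (t - s).
    rewrite -ltr_pdivrMr ?subr_gt0// mul1r; apply: lt_trans (truncnS_gt _) _.
    by rewrite -natrX ltr_nat ltn_expl.
  exists N; apply/eqP => E.
  have /andP[a _] := truncn_itv (mulr_ge0 (exprn_ge0 N (ler0n R 2)) s0).
  have := truncnS_gt (2 ^+ N * t); rewrite -/(dig N t) -E -natr1.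
  by move: a HN; rewrite -/(dig N s); lra.
move=> e; case: (ex_minnP e) => -[|k]; first by rewrite !dig0.
move=> Nk kmin; have Ek : dig k s = dig k t.
  by apply/eqP; apply: contraT => /kmin; rewrite ltnn.
exists k, (dig k s); split; first by apply: dig_lt; rewrite s0.
rewrite /halves left_halfE// right_halfE//.
(* With equal leading bits, [s < t] forces the differing bit to be 0 in [s] and 1 in [t]. *)
have := dig_mono k.+1 (ltW st); move: Nk; rewrite !digS// Ek.
by case: bit; case: bit; rewrite ?eqxx//=; lia.
Qed.

Lemma halves_uniq k l k' l' s t : (l < 2 ^ k)%N -> (l' < 2 ^ k')%N ->
  halves k l s t -> halves k' l' s t -> k = k' /\ l = l'.
Proof.
move=> lk lk' H H'; have [s0 _] := halves_itv lk H.
have := halves_beta lk H; rewrite (halves_beta lk' H') => -[E].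
split=> //; move: H H'; rewrite E /halves !left_halfE// => /andP[/eqP-> _] /andP[/eqP].
by move/double_inj.
Qed.

(** The products of halves partition the triangle [s < t < 1], so at most one term is nonzero, and
    there [k.+1] is [beta s t]. The sign of [c] is assumed on the triangle only, because [Pq] may be
    negative off it. *)
Lemma beta_series s t (c : R) : 0 <= s ->
  (s < t -> t < 1 -> 0 <= c) ->
  (\sum_(0 <= k <oo) (\sum_(l < 2 ^ k) (halves k l s t)%:R * (k.+1%:R * c))%:E
   = (((s < t) && (t < 1))%:R * ((beta s t)%:R * c))%:E)%E.
Proof.
move=> s0 c0; case: (boolP ((s < t) && (t < 1))) => [/andP[st t1]|nst]; last first.
  rewrite mul0r eseries0// => k _ _; rewrite big1// => l _.
  case: (boolP (halves k l s t)) => [H|]; last by rewrite mul0r.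
  by have [_ [st t1]] := halves_itv (ltn_ord l) H; rewrite st t1 in nst.
have [k [l [lk H]]] := halves_ex s0 st t1.
rewrite (@nneseriesD1 R _ k)//; last first.
  by move=> j _; rewrite lee_fin sumr_ge0// => i _; rewrite !mulr_ge0// c0.
rewrite eseries0 ?adde0 => [|j _ /= jk]; last first.
  rewrite big1// => i _; case: (boolP (halves j i s t)) => [H'|]; last by rewrite mul0r.
  by have [/esym/eqP] := halves_uniq lk (ltn_ord i) H H'; rewrite (negbTE jk).
rewrite (bigD1 (Ordinal lk))//= big1 => [|i ik]; last first.
  case: (boolP (halves k i s t)) => [H'|]; last by rewrite mul0r.
  have [_ E] := halves_uniq lk (ltn_ord i) H H'.
  by move: ik; rewrite -val_eqE/= -E eqxx.
by rewrite H (halves_beta lk H) addr0.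
Qed.

End Dyadic.

(** * Power sums and Bernoulli numbers *)

Lemma trinomial_revisionC (n r i : nat) : (r + i <= n)%N ->
  ('C(n, r) * 'C(n - r, i) = 'C(n, i) * 'C(n - i, r))%N.
Proof.
move=> rin; apply/eqP.
rewrite -(eqn_pmul2r (_ : 0 < r`! * i`! * (n - r - i)`!)%N); last first.
  by rewrite !muln_gt0 !fact_gt0.
have /bin_fact Er : (r <= n)%N by lia.
have /bin_fact Ei : (i <= n)%N by lia.
have /bin_fact Eri : (i <= n - r)%N by lia.
have /bin_fact Eir : (r <= n - i)%N by lia.
have E : (n - i - r = n - r - i)%N by lia.
rewrite E in Eir; apply/eqP.
transitivity n`!; first by rewrite -Er -Eri; ring.
by rewrite -Ei -Eir; ring.
Qed.

Section Faulhaber.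
Variable R : realType.

(** This is [B_(p+1)(x) - B_(p+1)], the Bernoulli polynomial without its constant term. *)
Definition bernoulli_pow_sum (p : nat) (x : R) : R :=
  \sum_(r < p.+1) 'C(p.+1, r)%:R * bernoulli R r * x ^+ (p.+1 - r).

(** After [(1 + x) ^+ (p.+1 - r)] is expanded and the sums are exchanged, the coefficient of
    [x ^+ i] is ['C(p.+1, i)] times the sum in [bernoulli_rec] at [p - i], which vanishes unless
    [i = p]. *)
Lemma bernoulli_pow_sum_shift (p : nat) (x : R) :
  bernoulli_pow_sum p (1 + x) = bernoulli_pow_sum p x + p.+1%:R * x ^+ p.
Proof.
rewrite [RHS]addrC; apply/eqP; rewrite -subr_eq /bernoulli_pow_sum -sumrB; apply/eqP.
transitivity (\sum_(r < p.+1) \sum_(i < p.+1 | (r + i < p.+1)%N)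
   'C(p.+1, i)%:R * x ^+ i * ('C(p.+1 - i, r)%:R * bernoulli R r)).
  apply: eq_bigr => r _; rewrite -mulrBr exprDn big_ord_recr/=.
  rewrite subnn expr0 mul1r binn mulr1n addrK mulr_sumr.
  rewrite (big_ord_widen_cond p.+1 xpredT (fun i => 'C(p.+1, r)%:R *
     bernoulli R r * ((1 : R) ^+ (p.+1 - r - i) * x ^+ i *+ 'C(p.+1 - r, i)))) ?leq_subr//.
  apply: eq_big => [i|i ri] /=; first by lia.
  rewrite expr1n mul1r -mulr_natr.
  have /(congr1 (fun k => k%:R : R)) := @trinomial_revisionC p.+1 r i ltac:(lia).
  rewrite !natrM => E.
  transitivity ('C(p.+1, r)%:R * 'C(p.+1 - r, i)%:R * (x ^+ i * bernoulli R r)).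
    by ring.
  by rewrite E; ring.
under eq_bigr do rewrite big_mkcond/=.
rewrite exchange_big/= (bigD1 ord_max)//= [X in X + _]big_ord_recl.
rewrite [X in _ + X + _]big1 => [|r _]; last by case: ifP => //=; rewrite /bump/=; lia.
rewrite [X in _ + X]big1 => [|i ip].
  rewrite !addr0 add0n ltnSn binSn bin0.
  by have := bernoulli_rec R 0; rewrite big_ord1 bin0 => E; rewrite E mulr1.
have ip' : (i < p)%N by have := ltn_ord i; move/eqP : ip => /eqP; rewrite -val_eqE/=; lia.
have E : (p.+1 - i = (p - i).+1)%N by lia.
have := bernoulli_rec R (p - i); rewrite -E.
rewrite (big_ord_widen p.+1 (fun r => 'C(p.+1 - i, r)%:R * bernoulli R r)) ?leq_subr//.
have -> : (p - i == 0)%N = false by lia.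
move=> S0; transitivity ('C(p.+1, i)%:R * x ^+ i * (false%:R : R)); last by rewrite mulr0.
rewrite -[in RHS]S0 [in RHS]big_mkcond mulr_sumr/=; apply: eq_bigr => r _.
rewrite (_ : (r + i < p.+1)%N = (r < p.+1 - i)%N); last by lia.
by case: ifP; rewrite ?mulr0.
Qed.

Lemma bernoulli_pow_sumE (p N : nat) :
  p.+1%:R * \sum_(l < N) l%:R ^+ p = bernoulli_pow_sum p N%:R.
Proof.
elim: N => [|N IH].
  rewrite big_ord0 mulr0 /bernoulli_pow_sum big1// => r _.
  by rewrite expr0n subn_eq0 leqNgt ltn_ord mulr0.
by rewrite big_ord_recr/= mulrDr IH -[N.+1%:R]nat1r bernoulli_pow_sum_shift.
Qed.

(* Summing up to [N] inclusive turns B_1 = -1/2 into the coefficient +1/2. *)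
Lemma faulhaber (p N : nat) :
  \sum_(l < N) (l.+1)%:R ^+ p =
  \sum_(r < p.+1) a_coef R p.+1 r * N%:R ^+ (p.+1 - r).
Proof.
have p0 : p.+1%:R != 0 :> R by rewrite pnatr_eq0.
(* The term [l = 0] on the left is [0 ^+ p], equal to 1 when [p = 0]; hence the correction on the
   right. *)
have H : \sum_(l < N) l%:R ^+ p + N%:R ^+ p = \sum_(l < N) l.+1%:R ^+ p + (p == 0)%:R :> R.
  have := big_ord_recr N (fun l => l%:R ^+ p) : \sum_(l < N.+1) (l%:R : R) ^+ p = _.
  by rewrite big_ord_recl/= expr0n => <-; rewrite addrC.
apply/(mulfI p0)/(addIr (p.+1%:R * (p == 0)%:R)).
rewrite -mulrDr -H mulrDr bernoulli_pow_sumE /bernoulli_pow_sum mulr_sumr.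
have a0 : 'C(p.+1, 0)%:R * bernoulli R 0 = p.+1%:R * a_coef R p.+1 0.
  have := bernoulli_rec R 0; rewrite big_ord1 !bin0 => ->.
  by rewrite /a_coef mulfV.
case: p p0 H a0 => [|p] p0 H a0.
  by rewrite !big_ord1 a0 subn0 eqxx expr0 !mulr1 mulrA.
rewrite 2!big_ord_recl [in RHS]big_ord_recl [X in _ = _ + X + _]big_ord_recl/=.
rewrite a0 mulr0 addr0 -mulrA -!addrA; congr (_ + _).
rewrite [X in _ + X]addrC addrA; congr (_ + _); last first.
  apply: eq_bigr => r _; rewrite /bump/= !add1n !mulrA; congr (_ * _).
  (* The identity [(r+2) 'C(p+2, r+2) = (p+2) 'C(p+1, r+1)] produces the division by [r] and the
     lowered binomial of [a_coef]. *)
  have /(congr1 (fun k => k%:R : R)) := mul_bin_diag p.+2 r.+1.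
  rewrite /= !natrM add0n => E.
  have r0 : r.+2%:R != 0 :> R by rewrite pnatr_eq0.
  apply: (mulfI r0); rewrite !mulrA -E.
  by move: r0; move: (r.+2%:R : R) => c c0; field.
have -> : bernoulli R 1 = - 2^-1.
  have := bernoulli_rec R 1.
  have := bernoulli_rec R 0; rewrite big_ord1 bin0 big_ord_recr/= big_ord1 !bin0 !bin1 mul1r.
  move=> ->; lra.
by rewrite bin1 /bump/= subn1/=; field.
Qed.
End Faulhaber.

(** * The coefficients [C2], [C4] and [C7] as coefficients of polynomials *)

Section CoefficientExpansion.
Variable R : realType.

(** Turns dependent bounds into conditions over a fixed range: such sums can be exchanged freely and
    their index domains compared by [lia]. *)
Lemma big_nat_ord_cond (V : nmodType) (N a b : nat) (F : nat -> V) : (b <= N)%N ->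
  \sum_(a <= i < b) F i = \sum_(i < N | (a <= i < b)%N) F i.
Proof.
move=> bN; by rewrite big_geq_mkord (big_ord_widen_cond N).
Qed.

(** A Cauchy product grouped by [j.-1 = a + b]; the inner bounds, those of [C4], say [a <= f] and
    [j.-1 - a <= h]. *)
Lemma sum_convolution (V : nmodType) (f h : nat) (F : nat -> nat -> V) :
  \sum_(a < f.+1) \sum_(b < h.+1) F a b =
  \sum_(1 <= j < (f + h + 2)%N)
    \sum_((j.-1 - h)%N <= a < (minn j.-1 f).+1) F a (j.-1 - a)%N.
Proof.
rewrite addnS addn1 big_add1/= big_mkord.
transitivity (\sum_(k < (f + h).+1) \sum_(a < f.+1 | (a <= k <= a + h)%N) F a (k - a)%N).
  rewrite [RHS](exchange_big_dep xpredT)//=; apply: eq_bigr => a _.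
  rewrite -(big_mkord xpredT (F a)).
  rewrite -(@big_nat_ord_cond _ (f + h).+1 a (a + h).+1 (fun k => F a (k - a)%N)).
    rewrite -{2}[a : nat]add0n big_addn (_ : (a + h).+1 - a = h.+1)%N; last by lia.
    by apply: eq_bigr => i _; rewrite addnK.
  by have := ltn_ord a; lia.
apply: eq_bigr => k _; rewrite (@big_nat_ord_cond _ f.+1).
  by apply: eq_bigl => a; have := ltn_ord a; lia.
by lia.
Qed.

Lemma exprB_binomial (n : nat) (x y : R) :
  (x - y) ^+ n.+1 - x ^+ n.+1 =
  \sum_(a < n.+1) 'C(n.+1, a)%:R * x ^+ a * (- y) ^+ (n.+1 - a).
Proof.
rewrite addrC -[x - y]addrC exprDn big_ord_recr/= subnn expr0 mul1r binn addrC addrK.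
by apply: eq_bigr => a _; rewrite -mulr_natl mulrA mulrAC.
Qed.

Lemma signz_mod2 (n : nat) (z k : int) : z = n%:Z + 2 * k ->
  (-1) ^ z = (-1) ^+ n :> R.
Proof.
move=> ->; rewrite expfzDr ?oppr_eq0 ?oner_eq0// -exprz_exp.
by rewrite (_ : (-1) ^ 2 = 1 :> R) ?exp1rz ?mulr1// -exprnP sqrrN expr1n.
Qed.

(** Here [l] is the right end of a cell of length 1, with left end [l - 1] and midpoint [l - 2^-1].
    The left side is [(f+1)(h+1)] times the integral of [s^f t^h] over left half times right half,
    and [C4] lists its coefficients in [l]. *)
Lemma C4_coefficient (f h : nat) (l : R) :
  ((l - 2^-1) ^+ f.+1 - (l - 1) ^+ f.+1) * (l ^+ h.+1 - (l - 2^-1) ^+ h.+1) =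
  \sum_(1 <= j < (f + h + 2)%N) C4 R f h j * l ^+ j.-1.
Proof.
have E c : \sum_(a < f.+1) 'C(f.+1, a)%:R * l ^+ a * (- c) ^+ (f.+1 - a) =
    (l - c) ^+ f.+1 - l ^+ f.+1 by rewrite exprB_binomial.
transitivity ((\sum_(a < f.+1) 'C(f.+1, a)%:R * l ^+ a *
    ((- 2^-1) ^+ (f.+1 - a) - (- 1) ^+ (f.+1 - a))) *
  - \sum_(b < h.+1) 'C(h.+1, b)%:R * l ^+ b * (- 2^-1) ^+ (h.+1 - b)).
  rewrite -exprB_binomial; under eq_bigr do rewrite mulrBr.
  by rewrite sumrB !E; ring.
rewrite mulrN mulr_suml -sumrN.
under eq_bigr do rewrite mulr_sumr -sumrN.
rewrite (sum_convolution f h (fun a b => - ('C(f.+1, a)%:R * l ^+ a *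
  ((-2^-1) ^+ (f.+1 - a) - (-1) ^+ (f.+1 - a)) *
  ('C(h.+1, b)%:R * l ^+ b * (- 2^-1) ^+ (h.+1 - b))))).
rewrite big_nat [RHS]big_nat; apply: eq_bigr => j jfh.
rewrite /C4 mulr_sumr mulr_suml big_nat [RHS]big_nat; apply: eq_bigr => a ajf.
have -> : (-1) ^ (f%:Z + h%:Z - j%:Z + 1) =
   (-1) ^+ (f.+1 - a) * (-1) ^+ (h.+1 - (j.-1 - a)) :> R.
  by rewrite -exprD; apply: (@signz_mod2 _ _ (-1)); lia.
rewrite (_ : l ^+ j.-1 = l ^+ a * l ^+ (j.-1 - a)); last by rewrite -exprD subnKC//; lia.
rewrite ![(- 2^-1) ^+ _]exprNn.
(* The powers of one half split into the prefactor of [C4], free of [a], and the factor left under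
   its sum. *)
have -> : 2^-1 ^+ (h.+1 - (j.-1 - a)) = 2^-1 ^ (h%:Z - j%:Z + 2) * 2^-1 ^+ a :> R.
  by rewrite exprnP exprnP -expfzDr ?invr_eq0 ?pnatr_eq0//; congr (_ ^ _); lia.
ring.
Qed.

Lemma big_nat_shift (V : nmodType) (a n : nat) (F : nat -> V) :
  \sum_(a <= i < (a + n)%N) F i = \sum_(k < n) F (a + k)%N.
Proof.
rewrite -{1}[a]add0n big_addn addnC addnK big_mkord.
by apply: eq_bigr => k _; rewrite addnC.
Qed.

(** Take [a = f+1-i] factors [- s] from [t - s] and [b = h+f+2-j] factors [- t] from [1 - t]: the
    exponents become [f] and [h]. The sign is that of [C2] because [a + b] and [h - i - j + 1] have
    the same parity. *)
Lemma expand_cell_monomial (n i j : nat) (s t : R) : (0 < i < j)%N -> (j <= n)%N ->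
  s ^+ i.-1 * (t - s) ^+ (j - i).-1 * (1 - t) ^+ (n - j) =
  \sum_(f < n | (i.-1 <= f < j.-1)%N) \sum_(h < n | (j - f.+2 <= h < n - f.+1)%N)
    'C((j - i).-1, f.+1 - i)%:R * 'C(n - j, h + f + 2 - j)%:R *
    (-1) ^ (h%:Z - i%:Z - j%:Z + 1) * s ^+ f * t ^+ h.
Proof.
move=> ij jn.
pose G f h := 'C((j - i).-1, f.+1 - i)%:R * 'C(n - j, h + f + 2 - j)%:R *
    (-1) ^ (h%:Z - i%:Z - j%:Z + 1) * s ^+ f * t ^+ h.
rewrite -(@big_nat_ord_cond _ n i.-1 j.-1 (fun f =>
  \sum_(h < n | (j - f.+2 <= h < n - f.+1)%N) G f h)); last by lia.
have -> : j.-1 = (i.-1 + (j - i).-1.+1)%N by lia.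
rewrite exprDn big_nat_shift mulr_sumr mulr_suml.
apply: eq_bigr => a _; have ha := ltn_ord a.
set f := (i.-1 + _)%N.
rewrite exprDn -(@big_nat_ord_cond _ n (j - f.+2) (n - f.+1) (G f)); last by lia.
have -> : (n - f.+1 = j - f.+2 + (n - j).+1)%N by rewrite /f; lia.
rewrite big_nat_shift mulr_sumr; apply: eq_bigr => b _.
have hb := ltn_ord b; rewrite /G; set h := (j - _ + _)%N.
have -> : (f.+1 - i = a)%N by rewrite /f; lia.
have -> : (h + f + 2 - j = b)%N by rewrite /h /f; lia.
have -> : (-1) ^ (h%:Z - i%:Z - j%:Z + 1) = (-1) ^+ a * (-1) ^+ b :> R.
  by rewrite -exprD; apply: (@signz_mod2 _ _ (- a%:Z - i%:Z)); rewrite /h /f; lia.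
have -> : t ^+ h = t ^+ ((j - i).-1 - a) * t ^+ b.
  by rewrite -exprD; congr (_ ^+ _); rewrite /h /f; lia.
rewrite /f exprD (exprNn s) (exprNn t) expr1n -!(mulr_natr (_ * _)).
move: (s ^+ i.-1) (s ^+ a) (t ^+ ((j - i).-1 - a)) (t ^+ b) ((-1) ^+ a : R)
  ((-1) ^+ b : R) ('C((j - i).-1, a)%:R : R) ('C(n - j, b)%:R : R) => *; ring.
Qed.

(** The expanded monomials are collected by [(f, h)]. The exponent of [s] runs from [i - 1] to
    [j - 2], which for given [f] is the range [i <= f + 1 < j] of [C2]. *)
Lemma Pq_expand q m n (s t : R) :
  Pq q m n s t =
  \sum_(0 <= f < n.-1) \sum_(0 <= h < (n - f.+1)%N) C2 R q m n f h * s ^+ f * t ^+ h.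
Proof.
pose G i j f h := C1 R q m n i j * ('C((j - i).-1, f.+1 - i)%:R * 'C(n - j, h + f + 2 - j)%:R *
    (-1) ^ (h%:Z - i%:Z - j%:Z + 1) * s ^+ f * t ^+ h).
transitivity (\sum_(i < n.+1) \sum_(j < n.+1 | (0 < i < j)%N)
  \sum_(f < n | (i.-1 <= f < j.-1)%N) \sum_(h < n | (j - f.+2 <= h < n - f.+1)%N)
  G i j f h).
  rewrite /Pq (@big_nat_ord_cond _ n.+1)// big_mkcond; apply: eq_bigr => i _.
  case: ifP => i0; last by rewrite big1// => j; have := ltn_ord i; have := ltn_ord j; lia.
  rewrite (@big_nat_ord_cond _ n.+1)//; apply: eq_big => [j|j ij]; first by have := ltn_ord j; lia.
  rewrite -!mulrA !(mulrA (s ^+ _)) expand_cell_monomial ?ltnS//; last 2 first.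
  - by lia.
  - by have := ltn_ord j; lia.
  by rewrite mulr_sumr; apply: eq_bigr => f _; rewrite mulr_sumr.
under eq_bigr do rewrite (exchange_big_dep xpredT)//=.
rewrite exchange_big/= [RHS](@big_nat_ord_cond _ n); last by lia.
rewrite [RHS]big_mkcond; apply: eq_bigr => f _.
transitivity (\sum_(i < n.+1) \sum_(h < n) \sum_(j < n.+1 |
  [&& (0 < i < j)%N, (i.-1 <= f < j.-1)%N & (j - f.+2 <= h < n - f.+1)%N]) G i j f h).
  apply: eq_bigr => i _; rewrite (exchange_big_dep xpredT)//=.
  by apply: eq_bigr => h _; apply: eq_bigl => j; rewrite -!andbA.
rewrite exchange_big/=.
case: ifP => fn; last first.
  by rewrite big1// => h _; rewrite big1// => i _; rewrite big1// => j; have := ltn_ord h; have := ltn_ord f; have := ltn_ord i; have := ltn_ord j; lia.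
rewrite (@big_nat_ord_cond _ n) ?leq_subr// [RHS]big_mkcond; apply: eq_bigr => h _.
case: ifP => hn; last first.
  by rewrite big1// => i _; rewrite big1// => j; have := ltn_ord i; have := ltn_ord j; lia.
rewrite /C2 (@big_nat_ord_cond _ n.+1); last by have := ltn_ord f; lia.
rewrite -mulrA mulr_suml [RHS]big_mkcond/=; apply: eq_bigr => i _.
case: ifP => fi; last by rewrite big1// => j; have := ltn_ord i; have := ltn_ord j; lia.
rewrite (@big_nat_ord_cond _ n.+1); last by lia.
rewrite mulr_suml; apply: eq_big => [j|j _]; first by have := ltn_ord j; have := ltn_ord i; have := ltn_ord h; have := ltn_ord f; lia.
by rewrite /G; ring.
Qed.

(** The substitution [a = f + h + 2 - j + r]: the bounds on [h] and [j] in [C7] say exactly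
    [0 <= r < j], where [r] is the second index of [a_coef]. *)
Lemma sum_C7 q m n (x : R) :
  \sum_(1 <= a < n) C7 R q m n a * x ^+ a =
  \sum_(0 <= f < n.-1) \sum_(0 <= h < (n - f.+1)%N) \sum_(1 <= j < (f + h + 2)%N)
    \sum_(r < j) a_coef R j r * C3 R q m n f h * C4 R f h j * x ^+ (f + h + 2 - j + r).
Proof.
pose G f h j a := a_coef R j (a + j - (f + h + 2))%N * C3 R q m n f h * C4 R f h j * x ^+ a.
transitivity (\sum_(1 <= a < n) \sum_(0 <= f < n.-1)
  \sum_(0 <= h < (n - f.+1)%N | (a - f.+1 <= h)%N)
  \sum_(1 <= j < (f + h + 2)%N | (f + h + 2 <= a + j)%N) G f h j a).
  apply: eq_bigr => a _; rewrite /C7 mulr_suml; apply: eq_bigr => f _.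
  rewrite mulr_suml (big_nat_widenl _ 0)//; apply: eq_big => [h|h _]; first by lia.
  rewrite mulr_suml (big_nat_widenl _ 1)//; last by lia.
  by rewrite big_nat_cond [RHS]big_nat_cond; apply: eq_bigl => j; lia.
rewrite exchange_big_nat/=; rewrite big_nat [RHS]big_nat; apply: eq_bigr => f fn.
rewrite (exchange_big_dep_nat xpredT)//=; rewrite big_nat [RHS]big_nat; apply: eq_bigr => h hn.
rewrite (exchange_big_dep_nat xpredT)//=; rewrite big_nat [RHS]big_nat; apply: eq_bigr => j jn.
transitivity (\sum_(f + h + 2 - j <= a < f + h + 2 - j + j) G f h j a).
  rewrite [RHS](big_nat_widenl _ 1)//; last by lia.
  rewrite [RHS](big_nat_widen _ _ n)//; last by lia.
  by rewrite big_nat_cond [RHS]big_nat_cond; apply: eq_bigl => a; lia.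
rewrite big_nat_shift; apply: eq_bigr => r _; rewrite /G.
by rewrite (_ : (_ + r + j - _)%N = r)//; lia.
Qed.

(** Scaling by [2 ^- k] costs a factor [2^(-k(f+h+2))], and Faulhaber's formula with [N = 2^k]
    returns the powers [2^(k(j-r))]. What is left is [2^(-ka)] with [a = f + h + 2 - j + r]. *)
Lemma half_cell_sum q m n k :
  \sum_(l < 2 ^ k) \sum_(0 <= f < n.-1) \sum_(0 <= h < (n - f.+1)%N)
    C2 R q m n f h *
    ((((l%:R + 2^-1) / 2 ^+ k) ^+ f.+1 - (l%:R / 2 ^+ k) ^+ f.+1) / f.+1%:R) *
    (((l.+1%:R / 2 ^+ k) ^+ h.+1 - ((l%:R + 2^-1) / 2 ^+ k) ^+ h.+1) / h.+1%:R) =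
  \sum_(1 <= a < n) C7 R q m n a * (2 ^- a) ^+ k.
Proof.
under [RHS]eq_bigr do rewrite exprVn exprAC -exprVn.
rewrite sum_C7 exchange_big/=; apply: eq_bigr => f _.
rewrite exchange_big/=; apply: eq_bigr => h _.
transitivity (\sum_(l < 2 ^ k) C3 R q m n f h * (2 ^- k) ^+ (f + h + 2) *
   (\sum_(1 <= j < (f + h + 2)%N) C4 R f h j * l.+1%:R ^+ j.-1)).
  apply: eq_bigr => l _; rewrite -C4_coefficient /C3 !exprMn.
  have -> : l.+1%:R - 2^-1 = l%:R + 2^-1 :> R by rewrite -natr1; field.
  have -> : l.+1%:R - 1 = l%:R :> R by rewrite -natr1 addrK.
  rewrite (_ : (f + h + 2 = f.+1 + h.+1)%N) ?exprD; last by lia.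
  rewrite invfM; ring.
rewrite -mulr_sumr exchange_big/= mulr_sumr [LHS]big_nat [RHS]big_nat.
apply: eq_bigr => j jn; rewrite -mulr_sumr.
case: j jn => // j jn; rewrite /= (faulhaber R j (2 ^ k)).
rewrite !mulr_sumr; apply: eq_bigr => r _.
have -> : (2 ^- k) ^+ (f + h + 2) = (2 ^- k) ^+ (f + h + 2 - j.+1 + r) * (2 ^- k) ^+ (j.+1 - r) :> R.
  by rewrite -exprD; congr (_ ^+ _); have := ltn_ord r; lia.
have K : (2 ^- k) ^+ (j.+1 - r) * (2 ^ k)%N%:R ^+ (j.+1 - r) = 1 :> R.
  by rewrite -exprMn natrX mulVf ?expr1n// expf_neq0// pnatr_eq0.
transitivity (a_coef R j.+1 r * C3 R q m n f h * C4 R f h j.+1 * (2 ^- k) ^+ (f + h + 2 - j.+1 + r) *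
  ((2 ^- k) ^+ (j.+1 - r) * (2 ^ k)%N%:R ^+ (j.+1 - r))); last by rewrite K mulr1.
move: (a_coef _ _ _) (C3 _ _ _ _ _ _) (C4 _ _ _ _) ((2 ^- k) ^+ (f + _ + _ - _ + _))
  ((2 ^- k) ^+ (j.+1 - r)) ((2 ^ k)%N%:R ^+ _) => *; ring.
Qed.

End CoefficientExpansion.

(** * The closed form of [mu_q] *)

Section Integrals.
Variable R : realType.
Local Notation mu := (@lebesgue_measure R).

Lemma integral_deriv_poly (F : {poly R}) (a b : R) : a < b ->
  (\int[mu]_(x in `[a, b[) (F^`().[x])%:E = (F.[b] - F.[a])%:E)%E.
Proof.
move=> ab.
rewrite integral_itv_bndo_bndc; last first.
  apply/measurable_EFinP; exact: measurable_poly.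
rewrite (@continuous_FTC2 _ _ (horner F))//.
- by apply: continuous_subspaceT; exact: continuous_horner.
- split => //.
  + by apply: cvg_at_right_filter; exact: continuous_horner.
  + by apply: cvg_at_left_filter; exact: continuous_horner.
- by move=> x _; rewrite derivE.
Qed.

(** Positivity on the triangle licenses the exchanges of series and integrals below. *)
Lemma Pq_ge0 q m n (s t : R) : 0 <= s -> s <= t -> t <= 1 -> 0 <= Pq q m n s t.
Proof.
move=> s0 st t1; apply: sumr_ge0 => i _; apply: sumr_ge0 => j _.
rewrite !mulr_ge0 ?exprn_ge0 ?subr_ge0// /C1.
have M : 0 <= multinom R n i j by rewrite /multinom divr_ge0// !mulr_ge0.
by case: q => [|[|[|[|]]]]//; rewrite !mulr_ge0// invr_ge0.
Qed.

Lemma left_half_lt k l : (l%:R / 2 ^+ k) < ((l%:R + 2^-1) / 2 ^+ k) :> R.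
Proof. by rewrite ltr_pM2r ?invr_gt0 ?exprn_gt0// ltrDl invr_gt0. Qed.

Lemma right_half_lt k l : ((l%:R + 2^-1) / 2 ^+ k) < (l.+1%:R / 2 ^+ k) :> R.
Proof. by rewrite ltr_pM2r ?invr_gt0 ?exprn_gt0// -[l.+1%:R]natr1 ltrD2l; lra. Qed.

Lemma measurable_mem_itv (i : interval R) (D : set R) : measurable D ->
  measurable_fun D (fun x : R => (x \in i)%:R : R).
Proof.
move=> mD; apply: (@measurable_funS _ _ _ _ setT) => //.
rewrite (_ : (fun _ => _) = \1_[set` i]); first exact: measurable_indic.
by apply/funext => x; rewrite indicE mem_setE.
Qed.

Definition Pq_cell_integral q m n k l (s : R) : R :=
  \sum_(0 <= f < n.-1) \sum_(0 <= h < (n - f.+1)%N) C2 R q m n f h * s ^+ f *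
   (((l.+1%:R / 2 ^+ k) ^+ h.+1 - ((l%:R + 2^-1) / 2 ^+ k) ^+ h.+1) / h.+1%:R).

Lemma integral_Pq_right_half q m n k l (s : R) :
  (\int[mu]_(t in [set` right_half R k l]) (Pq q m n s t)%:E =
   (Pq_cell_integral q m n k l s)%:E)%E.
Proof.
pose F : {poly R} := \sum_(0 <= f < n.-1) \sum_(0 <= h < (n - f.+1)%N)
  (C2 R q m n f h * s ^+ f / h.+1%:R) *: 'X^(h.+1).
have FE x : F.[x] = \sum_(0 <= f < n.-1) \sum_(0 <= h < (n - f.+1)%N)
  C2 R q m n f h * s ^+ f / h.+1%:R * x ^+ h.+1.
  rewrite /F horner_sum; apply: eq_bigr => f _; rewrite horner_sum.
  by apply: eq_bigr => h _; rewrite !hornerE.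
have F'E t : Pq q m n s t = F^`().[t].
  rewrite Pq_expand /F raddf_sum/= horner_sum; apply: eq_bigr => f _.
  rewrite raddf_sum/= horner_sum; apply: eq_bigr => h _.
  rewrite derivZ derivXn !hornerE hornerMn hornerXn -mulr_natr/=; field.
  by rewrite !nat1r !pnatr_eq0.
under eq_integral do rewrite F'E.
rewrite integral_deriv_poly ?right_half_lt//; congr (_%:E).
rewrite !FE -sumrB; apply: eq_bigr => f _; rewrite -sumrB; apply: eq_bigr => h _.
by field; rewrite !nat1r !pnatr_eq0.
Qed.

Lemma integral_Pq_cell q m n k l :
  (\int[mu]_(s in [set` left_half R k l]) (Pq_cell_integral q m n k l s)%:E =
   (\sum_(0 <= f < n.-1) \sum_(0 <= h < (n - f.+1)%N) C2 R q m n f h *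
    ((((l%:R + 2^-1) / 2 ^+ k) ^+ f.+1 - (l%:R / 2 ^+ k) ^+ f.+1) / f.+1%:R) *
    (((l.+1%:R / 2 ^+ k) ^+ h.+1 - ((l%:R + 2^-1) / 2 ^+ k) ^+ h.+1) / h.+1%:R))%:E)%E.
Proof.
pose d h : R := ((l.+1%:R / 2 ^+ k) ^+ h.+1 - ((l%:R + 2^-1) / 2 ^+ k) ^+ h.+1) / h.+1%:R.
pose F : {poly R} := \sum_(0 <= f < n.-1) \sum_(0 <= h < (n - f.+1)%N)
  (C2 R q m n f h * d h / f.+1%:R) *: 'X^(f.+1).
have FE x : F.[x] = \sum_(0 <= f < n.-1) \sum_(0 <= h < (n - f.+1)%N)
  C2 R q m n f h * d h / f.+1%:R * x ^+ f.+1.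
  rewrite /F horner_sum; apply: eq_bigr => f _; rewrite horner_sum.
  by apply: eq_bigr => h _; rewrite !hornerE.
have F'E s : Pq_cell_integral q m n k l s = F^`().[s].
  rewrite /Pq_cell_integral /F raddf_sum/= horner_sum; apply: eq_bigr => f _.
  rewrite raddf_sum/= horner_sum; apply: eq_bigr => h _.
  rewrite -/(d h) derivZ derivXn !hornerE hornerMn hornerXn -mulr_natr/=; field.
  by rewrite !nat1r !pnatr_eq0.
under eq_integral do rewrite F'E.
rewrite integral_deriv_poly ?left_half_lt//; congr (_%:E).
rewrite !FE -sumrB; apply: eq_bigr => f _; rewrite -sumrB; apply: eq_bigr => h _.
by rewrite -/(d h); field; rewrite !nat1r !pnatr_eq0.
Qed.

(** The coefficients [C2] carry signs, so positivity is read from the integral that the formula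
    evaluates. *)
Lemma Pq_cell_integral_ge0 q m n k l (s : R) : (l < 2 ^ k)%N -> s \in left_half R k l ->
  0 <= Pq_cell_integral q m n k l s.
Proof.
move=> lk hs; rewrite -lee_fin -integral_Pq_right_half.
apply: integral_ge0 => t /= ht; rewrite lee_fin.
have [s0 [/ltW st /ltW t1]] : 0 <= s /\ s < t /\ t < 1.
  by apply: (halves_itv lk); rewrite /halves hs ht.
exact: Pq_ge0.
Qed.

Lemma measurable_Pq q m n (s : R) (D : set R) : measurable D ->
  measurable_fun D (Pq q m n s).
Proof.
move=> mD; apply: measurable_sum => i; apply: measurable_sum => j.
apply: measurable_funM; last by apply: measurable_funX; exact: measurable_funB.
apply: measurable_funM; first exact: measurable_cst.
by apply: measurable_funX; apply: measurable_funB => //; exact: measurable_cst.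
Qed.

Lemma measurable_Pq_cell_integral q m n k l (D : set R) : measurable D ->
  measurable_fun D (Pq_cell_integral q m n k l).
Proof.
move=> mD; apply: measurable_sum => i; apply: measurable_sum => j.
apply: measurable_funM; last exact: measurable_cst.
by apply: measurable_funM; [exact: measurable_cst|exact: measurable_funX].
Qed.

(* For fixed [s] the inner integral of [mu_q] is cut along the right halves of the
   dyadic cells whose left half contains [s]. *)
Lemma inner_integral_series q m n (s : R) : s \in `]0, 1[ ->
  (\int[mu]_(t in `]s, 1%R[) ((beta s t)%:R * Pq q m n s t)%:E =
   \sum_(0 <= k <oo) (\sum_(l < 2 ^ k)
     (s \in left_half R k l)%:R * (k.+1%:R * Pq_cell_integral q m n k l s))%:E)%E.
Proof.
rewrite in_itv/= => /andP[s0 s1].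
pose g k (l : 'I_(2 ^ k)) t := (halves k l s t)%:R * (k.+1%:R * Pq q m n s t).
have g0 k (l : 'I_(2 ^ k)) t : 0 <= g k l t.
  rewrite /g; case: (boolP (halves k l s t)) => [H|]; last by rewrite mul0r.
  by have [_ [/ltW st /ltW t1]] := halves_itv (ltn_ord l) H; rewrite !mulr_ge0// Pq_ge0// ltW.
have mg k (l : 'I_(2 ^ k)) : measurable_fun setT (g k l).
  apply: measurable_funM; last first.
    by apply: measurable_funM; [exact: measurable_cst|exact: measurable_Pq].
  rewrite /halves; case: (s \in _) => /=; last exact: measurable_cst.
  exact: measurable_mem_itv.
(* The indicator in [beta_series] absorbs the domain []s, 1[], so the series is integrated over the
   whole line. *)
transitivity (\int[mu]_t (\sum_(0 <= k <oo) (\sum_(l < 2 ^ k) g k l t)%:E))%E.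
  rewrite integral_mkcond; apply: eq_integral => t _.
  rewrite beta_series; [|exact: ltW|by move=> st t1; rewrite Pq_ge0// ltW].
  rewrite patchE mem_setE in_itv/=.
  by case: (_ && _); rewrite ?mul1r ?mul0r.
rewrite integral_nneseries//; last 2 first.
- by move=> k; apply/measurable_EFinP/measurable_sum => l; exact: mg.
- by move=> k t _; rewrite lee_fin sumr_ge0.
apply: eq_eseriesr => k _; under eq_integral do rewrite -sumEFin.
rewrite ge0_integral_sum//; last 2 first.
- by move=> l; apply/measurable_EFinP; exact: mg.
- by move=> l t _; rewrite lee_fin.
rewrite -sumEFin.
apply: eq_bigr => l _; rewrite /g /halves.
case: (boolP (s \in left_half _ _ _)) => hs /=; last first.
  by rewrite mul0r; under eq_integral do rewrite mul0r; rewrite integral0.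
rewrite mul1r EFinM -integral_Pq_right_half -ge0_integralZl//; last 2 first.
- by apply/measurable_EFinP; exact: measurable_Pq.
- move=> t /= ht; have [_ [/ltW st /ltW t1]] : 0 <= s /\ s < t /\ t < 1.
    by apply: (halves_itv (ltn_ord l)); rewrite /halves hs ht.
  by rewrite lee_fin Pq_ge0// ltW.
rewrite [RHS]integral_mkcond; apply: eq_integral => t _.
by rewrite patchE mem_setE; case: ifP; rewrite ?mul1r ?mul0r// EFinM.
Qed.

Lemma mu_q_series q m n :
  (mu_q R q m n =
   \sum_(0 <= k <oo) (k.+1%:R * \sum_(1 <= a < n) C7 R q m n a * (2 ^- a) ^+ k)%:E)%E.
Proof.
rewrite /mu_q.
under eq_integral => s s01.
  rewrite inner_integral_series; last by move: s01; rewrite mem_setE.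
  over.
have cell_ge0 k (l : 'I_(2 ^ k)) (s : R) :
    0 <= (s \in left_half R k l)%:R * (k.+1%:R * Pq_cell_integral q m n k l s).
  case: (boolP (s \in left_half R k l)) => hs; last by rewrite mul0r.
  by rewrite !mulr_ge0// Pq_cell_integral_ge0.
have mcell k (l : 'I_(2 ^ k)) D : measurable D -> measurable_fun D (fun s : R =>
    (s \in left_half R k l)%:R * (k.+1%:R * Pq_cell_integral q m n k l s)).
  move=> mD; apply: measurable_funM; first exact: measurable_mem_itv.
  by apply: measurable_funM; [exact: measurable_cst|exact: measurable_Pq_cell_integral].
rewrite integral_nneseries//; last 2 first.
- by move=> k; apply/measurable_EFinP/measurable_sum => l; exact: mcell.
- by move=> k t _; rewrite lee_fin sumr_ge0.
apply: eq_eseriesr => k _; under eq_integral do rewrite -sumEFin.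
rewrite ge0_integral_sum//; last 2 first.
- by move=> l; apply/measurable_EFinP; exact: mcell.
- by move=> l t _; rewrite lee_fin.
rewrite -half_cell_sum mulr_sumr -sumEFin; apply: eq_bigr => l _.
rewrite EFinM -integral_Pq_cell -ge0_integralZl//; last 2 first.
- by apply/measurable_EFinP; exact: measurable_Pq_cell_integral.
- by move=> s /= hs; rewrite lee_fin Pq_cell_integral_ge0.
(* The left half of the cell [l = 0] contains 0, so this endpoint is added before the integral is
   restricted to the half. *)
rewrite integral_itv_obnd_cbnd; last by apply/measurable_EFinP; exact: mcell.
rewrite -[in RHS](@setIidr _ `[0, 1[ [set` left_half R k l]); last first.
  move=> s /=; rewrite /left_half !in_itv/= => /andP[a b].
  have K : 0 < 2 ^+ k :> R by rewrite exprn_gt0.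
  apply/andP; split; first by apply: le_trans a; rewrite divr_ge0// ltW.
  apply: lt_le_trans b _.
  rewrite ler_pdivrMr// mul1r; apply: (@le_trans _ _ l.+1%:R).
    by rewrite -[l.+1%:R]natr1 lerD2l; lra.
  by rewrite -natrX ler_nat.
rewrite integral_mkcondr; apply: eq_integral => s _.
by rewrite patchE mem_setE; case: ifP; rewrite ?mul1r ?mul0r// EFinM.
Qed.

Lemma cvg_sum_natmul_geometric (x : R) : 0 <= x <= 2^-1 ->
  (\sum_(0 <= k < N) k.+1%:R * x ^+ k) @[N --> \oo] --> (1 - x) ^- 2.
Proof.
move=> /andP[x0 x2].
have x1 : 1 - x != 0 by lra.
have E N : \sum_(0 <= k < N) k.+1%:R * x ^+ k =
    (1 - x ^+ N) / (1 - x) ^+ 2 - N%:R * x ^+ N / (1 - x).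
  elim: N => [|N IH]; first by rewrite big_nil expr0 subrr !mul0r subr0.
  by rewrite big_nat_recr//= IH (exprS x) -[N.+1%:R]natr1; field.
under eq_cvg do rewrite E.
have cx : x ^+ N @[N --> \oo] --> 0 by apply: cvg_expr; rewrite ger0_norm//; lra.
(* Squeeze: [N <= 2 (3/2)^N] by induction and [x^N <= 2^-N] give the bound [2 (3/4)^N]; the
   hypothesis [x <= 2^-1] leaves room for the base [3/2]. *)
have cNx : N%:R * x ^+ N @[N --> \oo] --> 0.
  have c34 : 2 * (3 / 4) ^+ N @[N --> \oo] --> (0 : R).
    rewrite -[0](mulr0 2); apply: cvgMl_tmp; apply: cvg_expr; rewrite ger0_norm; lra.
  apply: (squeeze_cvgr _ (@cvg_cst _ 0 _ _ _) c34); apply: nearW => N.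
  rewrite mulr_ge0 ?exprn_ge0//=.
  have B : N%:R <= 2 * (3 / 2) ^+ N :> R.
    suff : 1 + N%:R / 2 <= (3 / 2) ^+ N :> R by lra.
    elim: N => [|N IH]; first by rewrite expr0 mul0r addr0.
    rewrite exprS -natr1; have : 0 <= N%:R :> R by []; lra.
  have xN : x ^+ N <= 2^-1 ^+ N by apply: lerXn2r => //; rewrite nnegrE.
  apply: le_trans (ler_pM _ _ B xN) _; rewrite ?exprn_ge0//.
  by rewrite -mulrA -exprMn; have -> : 3 / 2 * 2^-1 = 3 / 4 :> R by lra.
have c1 : 1 - x ^+ N @[N --> \oo] --> (1 - 0 : R) by apply: cvgB => //; exact: cvg_cst.
have := cvgB (cvgMr_tmp (b := (1 - x) ^- 2) c1) (cvgMr_tmp (b := (1 - x)^-1) cNx).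
by rewrite mul0r !subr0 mul1r; apply.
Qed.

Theorem mu_q_closed_form q m n :
  mu_q R q m n = (\sum_(1 <= a < n) C7 R q m n a * (1 - 2 ^- a) ^- 2)%:E.
Proof.
have L : \sum_(0 <= k < N) k.+1%:R * \sum_(1 <= a < n) C7 R q m n a * (2 ^- a) ^+ k @[N --> \oo]
    --> \sum_(1 <= a < n) C7 R q m n a * (1 - 2 ^- a) ^- 2.
  (* The [C7] may have either sign, so the sum over [a] is exchanged with real partial sums instead
     of nonnegative series. Each ratio [2^-a] is at most one half because [a >= 1]. *)
  have E N : \sum_(0 <= k < N) k.+1%:R * \sum_(1 <= a < n) C7 R q m n a * (2 ^- a) ^+ k =
      \sum_(1 <= a < n) C7 R q m n a * \sum_(0 <= k < N) k.+1%:R * (2 ^- a) ^+ k.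
    under eq_bigr do rewrite mulr_sumr.
    rewrite exchange_big/=; apply: eq_bigr => a _; rewrite mulr_sumr.
    by apply: eq_bigr => k _; rewrite mulrCA.
  under eq_cvg do rewrite E big_nat.
  rewrite big_nat; apply: cvg_big => [|a /andP[a1 an]]; first exact: add_continuous.
  apply: cvgMl_tmp; apply: cvg_sum_natmul_geometric.
  rewrite invr_ge0 exprn_ge0//= lef_pV2 ?posrE ?exprn_gt0//.
  by rewrite -[leLHS]expr1 ler_eXn2l// ltr1n.
rewrite mu_q_series; apply/cvg_lim => //.
under eq_cvg do rewrite sumEFin.
by apply: cvg_EFin; [exact: nearW|exact: L].
Qed.

End Integrals.

(** * Averages over tables of pivot positions *)

Section PivotAverage.
Variables (R : realType) (n : nat).

(* Coordinate [c] of [g] is the pivot position in lists of [c.+1] elements. *)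
Definition pivots (g : {ffun 'I_n -> 'I_n}) (c : nat) : nat :=
  if c is c'.+1 then odflt 0%N (omap (fun i => val (g i)) (insub c')) else 0%N.

(** The uniform law on [0, ..., i], extended by 0 to ['I_n] so that all coordinates of a table have
    one type. *)
Definition pivot_weight (i k : 'I_n) : R := if (k <= i)%N then i.+1%:R^-1 else 0.

Definition pivot_avg (F : (nat -> nat) -> R) : R :=
  \sum_(g : {ffun 'I_n -> 'I_n}) (\prod_i pivot_weight i (g i)) * F (pivots g).

Lemma pivots_ord (g : {ffun 'I_n -> 'I_n}) (i : 'I_n) : pivots g i.+1 = g i.
Proof. by rewrite /pivots valK. Qed.

Lemma sum_pivot_weight (i : 'I_n) (H : nat -> R) :
  \sum_(k < n) pivot_weight i k * H k = i.+1%:R^-1 * \sum_(k < i.+1) H k.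
Proof.
rewrite (big_ord_widen n H)// mulr_sumr big_mkcond/= [RHS]big_mkcond; apply: eq_bigr => k _.
by rewrite /pivot_weight ltnS; case: ifP; rewrite ?mul0r.
Qed.

Lemma sum_pivot_weight1 (i : 'I_n) : \sum_(k < n) pivot_weight i k = 1.
Proof.
rewrite -[LHS]mulr1 mulr_suml (sum_pivot_weight i (fun=> 1)).
by rewrite sumr_const card_ord mulVf// pnatr_eq0.
Qed.

Lemma pivot_avg_cst (a : R) : pivot_avg (fun _ => a) = a.
Proof.
rewrite /pivot_avg -mulr_suml -bigA_distr_bigA/= big1 ?mul1r// => i _.
exact: sum_pivot_weight1.
Qed.

Lemma pivot_avgD F G : pivot_avg (fun u => F u + G u) = pivot_avg F + pivot_avg G.
Proof. by rewrite /pivot_avg -big_split; apply: eq_bigr => g _; rewrite mulrDr. Qed.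

(* Exchanging the pivot value [k] with coordinate [i] of [g] is an involution of the
   pairs [(k, g)] under which the weights are invariant. *)
Lemma pivot_avg_coord (i : 'I_n) (G : nat -> (nat -> nat) -> R) :
  (forall k u u', (k <= i)%N -> (forall c, c != i.+1 -> u c = u' c) -> G k u = G k u') ->
  pivot_avg (fun u => G (u i.+1) u) = i.+1%:R^-1 * \sum_(k < i.+1) pivot_avg (G k).
Proof.
move=> Gi; rewrite -(sum_pivot_weight i (fun k => pivot_avg (G k))).
pose flip (p : 'I_n * {ffun 'I_n -> 'I_n}) : 'I_n * {ffun 'I_n -> 'I_n} :=
  (p.2 i, [ffun j => if j == i then p.1 else p.2 j]).
have flipK : involutive flip.
  move=> [k g]; rewrite /flip/= ffunE eqxx; congr pair; apply/ffunP => j.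
  by rewrite !ffunE; case: eqP => [->|].
under [RHS]eq_bigr do rewrite mulr_sumr.
rewrite pair_big/= (reindex_inj (inv_inj flipK))/=.
(* The extra coordinate [k] may be summed in, since its weights add up to 1. *)
transitivity (\sum_(p : 'I_n * {ffun 'I_n -> 'I_n}) pivot_weight i p.1 *
  ((\prod_j pivot_weight j (p.2 j)) * G (pivots p.2 i.+1) (pivots p.2))).
  rewrite -(pair_big xpredT xpredT (fun k (g : {ffun 'I_n -> 'I_n}) => pivot_weight i k *
    ((\prod_j pivot_weight j (g j)) * G (pivots g i.+1) (pivots g))))/=.
  rewrite -[LHS]mul1r; under eq_bigr do rewrite -mulr_sumr.
  by rewrite -mulr_suml sum_pivot_weight1.
apply: eq_bigr => -[k g] _ /=.
rewrite valK/= (bigD1 i)//= [X in _ = _ * (X * _)](bigD1 i)//= ffunE eqxx.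
rewrite [in RHS](eq_bigr (fun j => pivot_weight j (g j))); last first.
  by move=> j /negbTE ji; rewrite ffunE ji.
(* The hypothesis on [G] covers [g i <= i]; otherwise the weight of [g i] vanishes on both sides. *)
case: (leqP (g i) i) => gi; last first.
  by rewrite /pivot_weight [(g i <= i)%N]leqNgt gi !(mul0r, mulr0).
have -> : G (g i) (pivots [ffun j => if j == i then k else g j]) = G (g i) (pivots g).
  apply: Gi => // -[|c]//; rewrite eqSS => ci; rewrite /pivots.
  case: insubP => //= j _ jc; rewrite ffunE ifN//; apply: contra ci => /eqP <-.
  by rewrite jc.
by rewrite -!mulrA mulrCA.
Qed.

End PivotAverage.

(** * Mean cost at fixed keys *)

Lemma qs_cost_recS (R : realType) d u m (s : seq R) : (0 < size s)%N ->
  qs_cost_rec d.+1 u m s =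
  let p := nth 0 s (u (size s)) in let k := (count (fun y => y < p) s).+1 in
  (\sum_(y <- s | y != p) beta y p +
   (if k == m then 0
    else if m < k then qs_cost_rec d u m [seq y <- s | (y < p)%R]
    else qs_cost_rec d u (m - k) [seq y <- s | (p < y)%R]))%N.
Proof. by case: s => // a s _; cbv zeta; rewrite -size_filter. Qed.

(** Lets the current pivot be separated from the rest of the run: recursive calls work on shorter
    lists, so by this lemma they ignore the entry of [u] at the present length. *)
Lemma qs_cost_rec_ext (R : realType) d (u u' : nat -> nat) m (s : seq R) :
  (forall c, (0 < c <= size s)%N -> u c = u' c) ->
  qs_cost_rec d u m s = qs_cost_rec d u' m s.
Proof.
elim: d m s => // d IH m s H.
case: (posnP (size s)) => [/size0nil -> //|s0]; rewrite !qs_cost_recS// H ?s0 ?leqnn//.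
have IHf (a : pred R) m' :
    qs_cost_rec d u m' [seq y <- s | a y] = qs_cost_rec d u' m' [seq y <- s | a y].
  apply: IH => c /andP[c0 cs]; apply: H; rewrite c0 (leq_trans cs)//.
  by rewrite size_filter count_size.
by rewrite /= !IHf.
Qed.

Section RankWeights.
Variable R : realType.
Implicit Types (s : seq R) (x y p : R).

Definition rank s x : nat := (count (fun z => z < x) s).+1.

Definition rank_weight (m i j : nat) : R := 2 / (maxn j m - minn i m + 1)%:R.

(** The candidate for the mean cost, by linearity over pairs. It is checked against the recursion of
    Quickselect rather than derived from the events that two given keys are compared. *)
Definition expected_cost (m : nat) s : R :=
  \sum_(x <- s) \sum_(y <- s | x < y) (beta x y)%:R * rank_weight m (rank s x) (rank s y).

Lemma rank_lt s x y : x \in s -> (rank s x < rank s y)%N = (x < y).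
Proof.
move=> xs; rewrite /rank ltnS; have [xy|yx] := ltP x y; last first.
  apply/negbTE; rewrite -leqNgt; apply: sub_count => z /=.
  by move=> zy; exact: lt_le_trans yx.
have -> : count (fun z => z < y) s =
  (count (fun z => (z < x)%R) s + count (fun z => (x <= z < y)%R) s)%N.
  rewrite -count_predUI [X in (_ + X)%N](@eq_count _ _ pred0).
    rewrite count_pred0 addn0; apply: eq_count => z /=; case: (ltP z x) => //= zx.
    exact: lt_trans xy.
  by move=> z /=; case: (ltP z x).
by rewrite -[X in (X < _)%N]addn0 ltn_add2l -has_count; apply/hasP; exists x; rewrite ?lexx.
Qed.

Lemma rank_le_size s x : x \in s -> (rank s x <= size s)%N.
Proof.
move=> xs; rewrite /rank -(count_predC (fun z => z < x) s) -[X in (X <= _)%N]addn1 leq_add2l.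
by rewrite -has_count; apply/hasP; exists x; rewrite //= ltxx.
Qed.

Lemma perm_rank_iota s : uniq s -> perm_eq (map (rank s) s) (iota 1 (size s)).
Proof.
move=> us; have um : uniq (map (rank s) s).
  rewrite map_inj_in_uniq// => x y xs ys E; apply/eqP; rewrite eq_le.
  by rewrite !leNgt -!(@rank_lt s)// E ltnn.
apply: uniq_perm => //; first exact: iota_uniq.
have sub : {subset map (rank s) s <= iota 1 (size s)}.
  by move=> i /mapP[x xs ->]; rewrite mem_iota add1n ltnS rank_le_size.
by have [] := uniq_min_size um sub _; rewrite ?size_map ?size_iota.
Qed.

Lemma count_rank s (a : pred nat) : uniq s ->
  count (fun p => a (rank s p)) s = count a (iota 1 (size s)).
Proof. by move=> us; rewrite -(permP (perm_rank_iota us)) count_map. Qed.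

Lemma count_rank_gt s r : uniq s -> (count (fun p => (r < rank s p)%N) s = size s - r)%N.
Proof.
move=> /(count_rank (fun i => (r < i)%N)) ->.
elim: (size s) => // N IH; rewrite -[N.+1]addn1 iotaD count_cat IH/= add1n addn0.
lia.
Qed.

Lemma count_rank_lt s r : uniq s -> (r <= size s)%N ->
  (count (fun p => (rank s p < r)%N) s = r.-1)%N.
Proof.
move=> us rs; have := count_predC (fun p => (r.-1 < rank s p)%N) s.
rewrite count_rank_gt// => E.
rewrite (@eq_count _ _ (predC (fun p => (r.-1 < rank s p)%N))) => [|p /=]; first by lia.
have : (0 < rank s p)%N by []; lia.
Qed.

Lemma rank_smaller s p x : x <= p -> rank [seq y <- s | y < p] x = rank s x.
Proof.
move=> xp; rewrite /rank count_filter; congr _.+1; apply: eq_count => z /=.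
by case: (ltP z x) => //= zx; exact: lt_le_trans xp.
Qed.

Lemma rank_larger s p x : uniq s -> p \in s -> p < x ->
  rank [seq y <- s | p < y] x = (rank s x - rank s p)%N.
Proof.
move=> us ps px; apply/eqP; rewrite -(eqn_add2r (rank s p)) subnK; last first.
  by rewrite ltnW// rank_lt.
rewrite /rank count_filter addSn; apply/eqP; congr _.+1.
have -> : (count (fun z => z < p) s).+1 = count (fun z => z <= p) s.
  rewrite (@eq_count _ (fun z => z <= p) (predU (fun z => z < p) (pred1 p))) => [|z /=]; last first.
    by rewrite le_eqVlt orbC.
  rewrite -[RHS]addn0 -[X in (_ = _ + X)%N](@count_pred0 _ s).
  rewrite -(@eq_count _ (predI (fun z => z < p) (pred1 p)) pred0) => [|z /=]; last first.
    by case: ltgtP.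
  by rewrite count_predUI count_uniq_mem// ps addn1.
rewrite -count_predUI [X in (_ + X)%N = _](@eq_count _ _ pred0) => [|z /=]; last first.
  by rewrite leNgt; case: (p < z); rewrite ?andbF.
rewrite count_pred0 addn0; apply: eq_count => z /=.
case: (leP z p) => zp /=; rewrite ?andbT ?orbT ?orbF//.
by rewrite (le_lt_trans zp px).
Qed.

Lemma size_smaller s p : (size [seq y <- s | (y < p)%R]).+1 = rank s p.
Proof. by rewrite size_filter. Qed.

Lemma size_larger s p : uniq s -> p \in s ->
  size [seq y <- s | p < y] = (size s - rank s p)%N.
Proof.
move=> us ps; rewrite size_filter -count_rank_gt//.
by apply: eq_in_count => y ys; rewrite rank_lt.
Qed.

Lemma rank_weightB m i j k : (k <= i)%N -> (k <= j)%N -> (k <= m)%N ->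
  rank_weight (m - k) (i - k) (j - k) = rank_weight m i j.
Proof. by move=> ki kj km; rewrite /rank_weight; congr (_ / _%:R); lia. Qed.

(** In the current call a pair is compared for two choices of pivot, its two members; hence the
    factor 2. *)
Lemma sum_beta_pairs s : uniq s ->
  \sum_(p <- s) \sum_(y <- s | y != p) (beta y p)%:R =
  \sum_(x <- s) \sum_(y <- s | x < y) (beta x y)%:R * 2 :> R.
Proof.
move=> us.
transitivity (\sum_(p <- s) \sum_(y <- s | p < y) (beta p y)%:R +
  \sum_(p <- s) \sum_(y <- s | y < p) (beta y p)%:R : R).
  rewrite -big_split/=; apply: eq_bigr => p _.
  rewrite (bigID (fun y => p < y))/=; congr (_ + _).
    apply: eq_big => [y|y _]; last by rewrite beta_sym.
    by case: (ltgtP p y).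
  by apply: eq_bigl => y; case: (ltgtP p y).
rewrite [X in _ + X](exchange_big_dep xpredT)//= -big_split/=.
by apply: eq_bigr => x _; rewrite -big_split/=; apply: eq_bigr => y _; rewrite mulr_natr mulr2n.
Qed.

Lemma sum_if_count (s : seq R) (P : pred R) (a : R) :
  \sum_(p <- s | P p) a = (count P s)%:R * a.
Proof. by rewrite big_const_seq iter_addr_0 mulr_natl. Qed.

(** A pair [x < y] survives into the smaller list exactly when the pivot has rank above [rank s y],
    and the search goes there when it is above [m]. This leaves [size s - max(rank s y, m)] pivots,
    and ranks do not change. *)
Lemma sum_smaller_cost m s : uniq s ->
  \sum_(p <- s | (m < rank s p)%N) expected_cost m [seq y <- s | y < p] =
  \sum_(x <- s) \sum_(y <- s | x < y) (beta x y)%:R *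
    (rank_weight m (rank s x) (rank s y) * (size s - maxn (rank s y) m)%:R).
Proof.
move=> us.
transitivity (\sum_(p <- s | (m < rank s p)%N) \sum_(x <- s) \sum_(y <- s | (x < y) && (y < p))
   (beta x y)%:R * rank_weight m (rank s x) (rank s y)).
  apply: eq_bigr => p _; rewrite /expected_cost big_filter [LHS]big_mkcond/=.
  apply: eq_bigr => x _; case: ifPn => xp.
    rewrite big_filter_cond; apply: eq_big => [y|y /andP[yp _]]; first by rewrite andbC.
    by rewrite !rank_smaller// ltW.
  rewrite big1_seq// => y /andP[/andP[xy yp] _].
  by rewrite (lt_trans xy yp) in xp.
rewrite exchange_big/=; apply: eq_bigr => x _.
rewrite (exchange_big_dep (fun y => x < y))/=; last by move=> p y _ /andP[].
rewrite [LHS]big_seq_cond [RHS]big_seq_cond; apply: eq_bigr => y /andP[ys xy].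
rewrite sum_if_count [RHS]mulrA [RHS]mulrC; congr (_%:R * _).
rewrite -count_rank_gt//; apply: eq_in_count => p ps.
by rewrite xy -(rank_lt _ ys) gtn_max andbC.
Qed.

(** Here the pivot must have rank below both [rank s x] and [m]. All ranks and [m] drop by the rank
    of the pivot, which leaves the weight unchanged, as it sees only differences. *)
Lemma sum_larger_cost m s : uniq s -> (m <= size s)%N ->
  \sum_(p <- s | (rank s p < m)%N) expected_cost (m - rank s p) [seq y <- s | p < y] =
  \sum_(x <- s) \sum_(y <- s | x < y) (beta x y)%:R *
    (rank_weight m (rank s x) (rank s y) * (minn (rank s x) m).-1%:R).
Proof.
move=> us ms.
transitivity (\sum_(p <- s | (rank s p < m)%N) \sum_(x <- s) \sum_(y <- s | (x < y) && (p < x))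
   (beta x y)%:R * rank_weight m (rank s x) (rank s y)).
  rewrite [LHS]big_seq_cond [RHS]big_seq_cond; apply: eq_bigr => p /andP[ps pm].
  rewrite /expected_cost big_filter [LHS]big_mkcond/= [LHS]big_seq [RHS]big_seq.
  apply: eq_bigr => x xs; case: ifPn => px; last by rewrite big_pred0// => y; rewrite andbF.
  rewrite big_filter_cond [LHS]big_seq_cond [RHS]big_seq_cond; apply: eq_big => [y|y /and3P[ys py xy]].
    case: (y \in s) => //=; case: (ltP x y) => xy; rewrite ?andbF//= andbT.
    exact: lt_trans xy.
  rewrite !rank_larger// rank_weightB//; try exact: ltnW.
    by rewrite ltnW// rank_lt.
  by rewrite ltnW// rank_lt.
rewrite exchange_big/=; rewrite [LHS]big_seq [RHS]big_seq; apply: eq_bigr => x xs.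
rewrite (exchange_big_dep (fun y => x < y))/=; last by move=> p y _ /andP[].
apply: eq_bigr => y xy.
rewrite sum_if_count [RHS]mulrA [RHS]mulrC; congr (_%:R * _).
rewrite -(@count_rank_lt s)// ?geq_min ?ms ?orbT//; apply: eq_in_count => p ps.
by rewrite xy -(rank_lt _ ps) leq_min andbC.
Qed.

Lemma expected_cost_step m s : uniq s -> (0 < m <= size s)%N ->
  (size s)%:R * expected_cost m s =
  \sum_(p <- s) (\sum_(y <- s | y != p) (beta y p)%:R +
    if rank s p == m then 0
    else if (m < rank s p)%N then expected_cost m [seq y <- s | y < p]
    else expected_cost (m - rank s p) [seq y <- s | p < y]).
Proof.
move=> us /andP[m0 ms]; rewrite big_split/= sum_beta_pairs//.
have -> : \sum_(p <- s) (if rank s p == m then 0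
    else if (m < rank s p)%N then expected_cost m [seq y <- s | y < p]
    else expected_cost (m - rank s p) [seq y <- s | p < y]) =
  \sum_(p <- s | (m < rank s p)%N) expected_cost m [seq y <- s | y < p] +
  \sum_(p <- s | (rank s p < m)%N) expected_cost (m - rank s p) [seq y <- s | p < y].
  rewrite big_mkcond [X in _ = X + _]big_mkcond [X in _ = _ + X]big_mkcond -big_split.
  by apply: eq_bigr => p _ /=; case: ltngtP; rewrite ?addr0 ?add0r.
rewrite sum_smaller_cost// sum_larger_cost// -!big_split/= /expected_cost.
rewrite mulr_sumr [LHS]big_seq [RHS]big_seq; apply: eq_bigr => x xs.
rewrite mulr_sumr -!big_split/= [LHS]big_seq_cond [RHS]big_seq_cond.
apply: eq_bigr => y /andP[ys xy]; rewrite /rank_weight.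
have xyr : (rank s x < rank s y)%N by rewrite rank_lt.
have := rank_le_size ys; have : (0 < rank s x)%N by [].
move: (rank s x) (rank s y) (size s) (beta x y) xyr ms => i j N b ij mN i0 jN.
set D := (maxn j m - minn i m + 1)%N.
(* Of the [N] pivots, [N - max(j, m)] keep the pair in the smaller list and [min(i, m) - 1] keep it
   in the larger one. The other [D] end its history, two of them with a comparison, in accordance
   with [D * (2 / D) = 2]. *)
have -> : N%:R = D%:R + (N - maxn j m)%:R + (minn i m).-1%:R :> R.
  by rewrite -!natrD; congr _%:R; rewrite /D; lia.
have D0 : D%:R != 0 :> R by rewrite pnatr_eq0 /D; lia.
by field.
Qed.

End RankWeights.

Section ExpectedCost.
Variable R : realType.

(** Averaging the coordinate for the current length by [pivot_avg_coord] and using the induction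
    hypothesis on the sublists turns the claim into [expected_cost_step]. *)
Lemma pivot_avg_cost (n d m : nat) (s : seq R) :
  (size s <= n)%N -> (size s <= d)%N -> uniq s -> (0 < m <= size s)%N ->
  pivot_avg n (fun u => (qs_cost_rec d u m s)%:R) = expected_cost m s.
Proof.
elim: d m s => [|d IH] m s sn sd us /andP[m0 ms]; first by lia.
have s0 : (0 < size s)%N by apply: leq_trans ms.
pose G k u : R := let p := nth 0 s k in (\sum_(y <- s | y != p) (beta y p)%:R) +
  (if rank s p == m then 0
    else if (m < rank s p)%N then (qs_cost_rec d u m [seq y <- s | y < p])%:R
    else (qs_cost_rec d u (m - rank s p) [seq y <- s | p < y])%:R).
have Es : size s = (size s).-1.+1 by rewrite prednK.
have i0 : ((size s).-1 < n)%N by rewrite -Es.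
pose i := Ordinal i0.
have Ei : i.+1 = size s by rewrite prednK.
transitivity (pivot_avg n (fun u => G (u i.+1) u)).
  congr pivot_avg; apply/funext => u; rewrite Ei qs_cost_recS//.
  by rewrite /G natrD natr_sum; congr (_ + _); case: ifP => // _; case: ifP.
rewrite pivot_avg_coord; last first.
  (* Both sublists omit the pivot, so their sizes stay below [i.+1], the one entry where [u] and
     [u'] may differ. *)
  move=> k u u'; rewrite -ltnS Ei => ks uu'.
  have ps : nth 0 s k \in s by rewrite mem_nth.
  congr (_ + _); case: ifP => // _; case: ifP => _; congr _%:R; apply: qs_cost_rec_ext => c /andP[_ cs];
    apply: uu'; rewrite neq_ltn (leq_ltn_trans cs)//.
    by rewrite size_smaller rank_le_size.
  by rewrite size_larger//; have : (0 < rank s (nth 0%R s k))%N by []; lia.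
apply: (@mulfI _ (size s)%:R); first by rewrite pnatr_eq0 -lt0n.
rewrite expected_cost_step ?m0// Ei mulrA mulfV ?mul1r ?pnatr_eq0 -?lt0n//.
rewrite [RHS](big_nth 0) big_mkord; apply: eq_bigr => k _.
have ps : nth 0 s k \in s by rewrite mem_nth.
rewrite /G pivot_avgD pivot_avg_cst; congr (_ + _).
have := rank_le_size ps; have := size_smaller s (nth 0 s k); have := size_larger us ps.
have : (0 < rank s (nth 0%R s k))%N by [].
move: (rank s (nth 0 s k)) => r r0 lp sp rp.
case: ltngtP => [km|mk|_]; last by rewrite pivot_avg_cst.
  have E : size [seq y <- s | y < nth 0 s k] = r.-1 by rewrite -sp.
  by rewrite IH ?filter_uniq ?E//; lia.
by rewrite IH ?filter_uniq ?lp//; lia.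
Qed.

End ExpectedCost.

(** * From independent events to product measures *)

Section Independence.
Context d (T : measurableType d) (R : realType) (P : probability T R).
Variables (I : finType) (G : I -> set (set T)).
Hypothesis Gm : forall i A, G i A -> measurable A.
Hypothesis GT : forall i, G i setT.
Hypothesis GI : forall i, setI_closed (G i).
Hypothesis indep : mutually_independent P G.

(* The pi-system generating the sigma-algebra of the classes [G i], [i] in [J]. *)
Definition rects (J : {set I}) : set (set T) :=
  [set A | exists2 E : I -> set T, (forall i, i \in J -> G i (E i)) &
     A = \bigcap_(i in [set` J]) E i].

Lemma rectsT J : rects J setT.
Proof. by exists (fun=> setT) => //; rewrite bigcapT. Qed.

Lemma rectsI J : setI_closed (rects J).
Proof.
move=> _ _ [E GE ->] [F GF ->]; exists (fun i => E i `&` F i); last by rewrite bigcapI.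
by move=> i iJ; apply: GI; [exact: GE|exact: GF].
Qed.

Lemma rects_measurable J : rects J `<=` measurable.
Proof.
move=> _ [E GE ->]; apply: fin_bigcap_measurable => //.
by move=> i iJ; apply: Gm; exact: GE.
Qed.

Lemma rects1 (J : {set I}) i A : i \in J -> G i A -> rects J A.
Proof.
move=> iJ GA; exists (fun j => if j == i then A else setT).
  by move=> j _; case: eqP => [->|].
rewrite eqEsubset; split => w; last by move/(_ i iJ); rewrite eqxx.
by move=> Aw j _; case: eqP.
Qed.

Lemma rects_indep (J1 J2 : {set I}) A B : (forall i, i \in J1 -> i \notin J2) ->
  rects J1 A -> rects J2 B -> P (A `&` B) = (P A * P B)%E.
Proof.
move=> J12 [E GE ->] [F GF ->].
(* Disjointness lets the two families be spliced into one over the union, to which [indep]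
   applies. *)
pose H i := if i \in J1 then E i else F i.
have J2N1 i : i \in J2 -> i \notin J1.
  by move=> iJ2; apply: contraTN iJ2 => /J12.
have -> : \bigcap_(i in [set` J1]) E i `&` \bigcap_(i in [set` J2]) F i =
    \bigcap_(i in [set` J1 :|: J2]) H i.
  rewrite eqEsubset; split => w.
    move=> [wE wF] i /=; rewrite inE /H; case: ifPn => [iJ1 _|_ /= iJ2].
      exact: wE.
    exact: wF.
  move=> wH; split => i /= iJ; have := wH i; rewrite /= inE iJ ?orbT => /(_ isT).
    by rewrite /H iJ.
  by rewrite /H (negbTE (J2N1 _ iJ)).
rewrite !indep//; last first.
  by move=> i; rewrite inE /H; case: ifPn => [iJ1 _|_ /= iJ2]; [exact: GE|exact: GF].
rewrite (eq_bigl (fun i => i \in [predU J1 & J2])) => [|i]; last by rewrite !inE.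
rewrite bigU/=; last first.
  by rewrite disjoint_subset; apply/fintype.subsetP => i /J12.
congr (_ * _)%E; apply: eq_bigr => i iJ; rewrite /H ?iJ//.
by rewrite (negbTE (J2N1 _ iJ)).
Qed.

Lemma sigma_rects_measurable J : <<s rects J >> `<=` measurable.
Proof. by apply: smallest_sub; [exact: sigma_algebra_measurable|exact: rects_measurable]. Qed.

(** [m1] restricts [P] to the event [A] and [m2] scales [P] by [P A]; these finite measures agree on
    the pi-system [rects J2], hence on the sigma-algebra it generates. *)
Lemma sigma_rects_indep1 (J1 J2 : {set I}) A B : (forall i, i \in J1 -> i \notin J2) ->
  rects J1 A -> <<s rects J2 >> B -> P (A `&` B) = (P A * P B)%E.
Proof.
move=> J12 rA; have mA := rects_measurable rA.
have PA : (0 <= fine (P A))%R by rewrite fine_ge0.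
pose m1 := mrestr P mA; pose m2 := mscale (NngNum PA) P.
move=> sB; transitivity (m1 B); first by rewrite /m1/= /mrestr setIC.
transitivity (m2 B); last by rewrite /m2/= /mscale/= fineK// fin_num_measure.
apply: (g_sigma_algebra_measure_unique (rects J2) (@rects_measurable J2) (fun=> setT)) => //.
- by move=> _; exact: rectsT.
- by rewrite bigcup_const.
- exact: rectsI.
- move=> C rC; rewrite /m1 /m2/= /mrestr /mscale/= fineK ?fin_num_measure// setIC.
  exact: (rects_indep J12 rA rC).
- by move=> k; rewrite /m1/= /mrestr setTI -ge0_fin_numE// fin_num_measure.
Qed.

(** The same uniqueness argument with [B] held fixed; agreement on the rectangles of [J1] is the
    previous lemma. *)
Lemma sigma_rects_indep (J1 J2 : {set I}) A B : (forall i, i \in J1 -> i \notin J2) ->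
  <<s rects J1 >> A -> <<s rects J2 >> B -> P (A `&` B) = (P A * P B)%E.
Proof.
move=> J12 + sB; have mB := sigma_rects_measurable sB.
have PB : (0 <= fine (P B))%R by rewrite fine_ge0.
pose m1 := mrestr P mB; pose m2 := mscale (NngNum PB) P.
move=> sA; transitivity (m1 A) => //.
transitivity (m2 A); last by rewrite /m2/= /mscale/= fineK ?fin_num_measure// muleC.
apply: (g_sigma_algebra_measure_unique (rects J1) (@rects_measurable J1) (fun=> setT)) => //.
- by move=> _; exact: rectsT.
- by rewrite bigcup_const.
- exact: rectsI.
- move=> C rC; rewrite /m1 /m2/= /mrestr /mscale/= fineK ?fin_num_measure// muleC.
  exact: (sigma_rects_indep1 J12 rC sB).
- by move=> k; rewrite /m1/= /mrestr setTI -ge0_fin_numE// fin_num_measure.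
Qed.

End Independence.

Section IndependentFubini.
Context d (T : measurableType d) (R : realType) (P : probability T R).
Context d1 d2 (T1 : measurableType d1) (T2 : measurableType d2).
Variables (Y : {mfun T >-> T1}) (Z : {mfun T >-> T2}).
Hypothesis YZ : forall A B, measurable A -> measurable B ->
  P (Y @^-1` A `&` Z @^-1` B) = (P (Y @^-1` A) * P (Z @^-1` B))%E.

(** Independence identifies the law of [(Y, Z)] with the product of the marginal laws, by uniqueness
    of a measure with given values on rectangles; the rest is Tonelli. *)
Lemma indep_fubini (phi : T1 * T2 -> \bar R) : measurable_fun setT phi ->
  (forall z, 0 <= phi z)%E ->
  (\int[P]_w phi (Y w, Z w) = \int[P]_w1 \int[P]_w2 phi (Y w1, Z w2))%E.
Proof.
move=> mphi phi0.
have mYZ : measurable_fun setT (fun w => (Y w, Z w)) by exact: measurable_fun_pair.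
transitivity (\int[pushforward P (fun w => (Y w, Z w))]_z phi z)%E.
  by rewrite ge0_integral_pushforward.
pose YZm : {mfun T >-> (T1 * T2)%type} := HB.pack (fun w => (Y w, Z w))
  (isMeasurableFun.Build _ _ _ _ _ mYZ).
transitivity (\int[(distribution P Y \x distribution P Z)%E]_z phi z)%E.
  apply: (@eq_measure_integral _ _ _ _ (distribution P Y \x distribution P Z)%E
    (distribution P YZm)) => C mC _.
  have H (A : set T1) (B : set T2) : measurable A -> measurable B ->
      distribution P YZm (A `*` B) = (distribution P Y A * distribution P Z B)%E.
    by move=> mA mB; exact: YZ.
  by have /esym -> := product_measure_unique H mC.
rewrite fubini_tonelli1//.
have mF : measurable_fun setT (fubini_F (distribution P Z) phi).
  exact: measurable_fun_fubini_tonelli_F.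
rewrite ge0_integral_distribution//; last by move=> y; exact: integral_ge0.
apply: eq_integral => w _; rewrite /= /fubini_F ge0_integral_distribution//.
exact: measurableT_comp.
Qed.

End IndependentFubini.

(** * Measurability of [beta] and of the cost *)

Section Measurability.
Context (R : realType) d (T : measurableType d).

Lemma measurable_b2r (f : T -> bool) : measurable_fun setT f ->
  measurable_fun setT (fun w => (f w)%:R : R).
Proof.
move=> mf; rewrite (_ : (fun w => _) = (fun w => if f w then 1 else 0 : R)); last first.
  by apply/funext => w; case: (f w).
by apply: measurable_fun_ifT => //; exact: measurable_cst.
Qed.

Lemma measurable_fun_to_nat (f : T -> nat) : (forall c, measurable (f @^-1` [set c])) ->
  measurable_fun setT f.
Proof.
move=> mf _ Y _; rewrite setTI (_ : f @^-1` Y = \bigcup_(c in Y) f @^-1` [set c]).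
  exact: bigcup_measurable.
by rewrite eqEsubset; split => [w Yw|w [c Yc /= fc]]; [exists (f w)|rewrite /= fc].
Qed.

(** Gluing along a finite-valued function, as a sum of indicators times [F c]; this spares [C] a
    measurable structure. *)
Lemma measurable_finite_case (C : finType) (kappa : T -> C) (F : C -> T -> R) :
  (forall c, measurable_fun setT (fun w => (kappa w == c)%:R : R)) ->
  (forall c, measurable_fun setT (F c)) ->
  measurable_fun setT (fun w => F (kappa w) w).
Proof.
move=> mk mF.
rewrite (_ : (fun w => _) = (fun w => \sum_(c : C) (kappa w == c)%:R * F c w)).
  by apply: measurable_sum => c; exact: measurable_funM.
apply/funext => w; rewrite (bigD1 (kappa w))//= eqxx mul1r big1 ?addr0// => c /negbTE.
by rewrite eq_sym => ->; rewrite mul0r.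
Qed.

Lemma measurable_ffun_case (I : finType) (b : I -> T -> bool) (F : {ffun I -> bool} -> T -> R) :
  (forall i, measurable_fun setT (b i)) ->
  (forall c, measurable_fun setT (F c)) ->
  measurable_fun setT (fun w => F [ffun i => b i w] w).
Proof.
move=> mb; apply: (measurable_finite_case (kappa := fun w => [ffun i => b i w])) => c.
rewrite (_ : (fun w => _) = (fun w => \prod_(i : I) (b i w == c i)%:R)).
  apply: measurable_prod => i _; case: (c i).
    by rewrite (_ : (fun w => _) = (fun w => (b i w)%:R)); [exact: measurable_b2r|];
      apply/funext => w; rewrite eqb_id.
  rewrite (_ : (fun w => _) = (fun w => 1 - (b i w)%:R)).
    by apply: measurable_funB; [exact: measurable_cst|exact: measurable_b2r].
  by apply/funext => w; case: (b i w); rewrite ?subrr ?subr0.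
apply/funext => w; case: eqP => [<-|bc].
  by rewrite big1// => i _; rewrite ffunE eqxx.
have [i bi] : exists i, b i w != c i.
  by apply/existsP; apply: contra_notT bc => /existsPn H; apply/ffunP => i;
    rewrite ffunE; apply/eqP; have := H i; rewrite negbK.
by rewrite (bigD1 i)//= (negbTE bi) mul0r.
Qed.

End Measurability.

Section MeasurableBeta.
Variable R : realType.

Lemma measurable_bit (k : nat) : measurable [set x : R | bit k x].
Proof.
have K : 0 < 2 ^+ k :> R by rewrite exprn_gt0.
rewrite (_ : [set x | _] =
  \bigcup_(l in odd) `[l%:R / 2 ^+ k, l.+1%:R / 2 ^+ k[%classic).
  by apply: bigcup_measurable => l _; exact: measurable_itv.
rewrite eqEsubset; split => x.
  rewrite /= /bit => o; exists (Num.truncn (2 ^+ k * x)) => //=.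
  (* An odd truncation is nonzero, which rules out negative [x]. *)
  have t0 : (0 < Num.truncn (2 ^+ k * x))%N by case: (Num.truncn _) o.
  have x0 : 0 <= 2 ^+ k * x by move: t0; rewrite truncn_gt0; apply: le_trans.
  by rewrite in_itv/= ler_pdivrMr// ltr_pdivlMr// [x * _]mulrC truncn_itv.
move=> [l ol] /=; rewrite in_itv/= ler_pdivrMr// ltr_pdivlMr// [x * _]mulrC => H.
by rewrite /bit (truncn_def H).
Qed.

Lemma measurable_beta : measurable_fun setT (fun z : R * R => (beta z.1 z.2)%:R : R).
Proof.
pose A k : set (R * R) := [set z | bit k.+1 z.1 != bit k.+1 z.2].
have mA k : measurable (A k).
  have m1 : measurable (fst @^-1` [set x : R | bit k.+1 x] : set (R * R)).
    by rewrite -[X in measurable X]setTI; apply: measurable_fst => //; exact: measurable_bit.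
  have m2 : measurable (snd @^-1` [set x : R | bit k.+1 x] : set (R * R)).
    by rewrite -[X in measurable X]setTI; apply: measurable_snd => //; exact: measurable_bit.
  rewrite (_ : A k = (fst @^-1` [set x | bit k.+1 x] `\` snd @^-1` [set x | bit k.+1 x]) `|`
     (snd @^-1` [set x | bit k.+1 x] `\` fst @^-1` [set x | bit k.+1 x])).
    by apply: measurableU; exact: measurableD.
  rewrite eqEsubset; split => -[x y]; rewrite /A/=; case: (bit k.+1 x); case: (bit k.+1 y) => //=.
  - by move=> _; left; split.
  - by move=> _; right; split.
  - by move=> [[]|[]].
  - by move=> [[]|[]].
suff mb : measurable_fun setT (fun z : R * R => beta z.1 z.2).
  move=> _ Y mY; rewrite setTI.
  by have := mb measurableT [set c : nat | Y c%:R] I; rewrite setTI.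
(* The fibre over 0 is the junk case in which no bit differs; the fibre over [c.+1] is [A c] without
   the earlier [A k]. *)
apply: measurable_fun_to_nat => -[|c].
  rewrite (_ : _ @^-1` _ = ~` \bigcup_k A k).
    by apply: measurableC; exact: bigcup_measurable.
  rewrite eqEsubset; split => -[x y] /=; rewrite /beta/=.
    by case: pselect => // ne _ [k _ Ak]; apply: ne; exists k.
  by case: pselect => // -[k Ak] ne; exfalso; apply: ne; exists k.
rewrite (_ : _ @^-1` _ = A c `\` \bigcup_(k in `I_c) A k).
  by apply: measurableD => //; exact: bigcup_measurable.
rewrite eqEsubset; split => -[x y] /=; rewrite /beta/=.
  case: pselect => // e; case: ex_minnP => k bk kmin [<-]; split => //.
  by move=> [j /= jk /kmin]; rewrite leqNgt jk.
case: pselect => [e|ne] [Ac nA]; last by exfalso; apply: ne; exists c.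
case: ex_minnP => k bk kmin; congr _.+1; apply/eqP; rewrite eqn_leq kmin//=.
by rewrite leqNgt; apply/negP => kc; apply: nA; exists k.
Qed.

End MeasurableBeta.

Section MeasurableCost.
Context (R : realType) d (T : measurableType d) (I : finType).
Variables (v : I -> T -> R) (u : nat -> T -> nat).
Hypothesis mv : forall i, measurable_fun setT (v i).
Hypothesis mu : forall c, measurable_fun setT (u c).

Lemma measurable_nth_keys (l : seq I) (c : nat) :
  measurable_fun setT (fun w => nth 0 [seq v i w | i <- l] c).
Proof.
by elim: l c => [|i l IH] [|c] //=; exact: measurable_cst.
Qed.

Lemma measurable_nth_pivot (l : seq I) (c : nat) :
  measurable_fun setT (fun w => nth 0 [seq v i w | i <- l] (u c w)).
Proof.
(* Positions beyond the list all yield the default 0, so capping them at [size l] changes nothing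
   and leaves finitely many cases. *)
rewrite (_ : (fun w => _) = (fun w => nth 0 [seq v i w | i <- l]
   (inord (minn (u c w) (size l)) : 'I_(size l).+1))); last first.
  apply/funext => w; rewrite inordK ?ltnS ?geq_minr//.
  case: leqP => // lu; rewrite !nth_default ?size_map//; exact: ltnW.
apply: (measurable_finite_case (F := fun (k : 'I_(size l).+1) w => nth 0 [seq v i w | i <- l] k)
  (kappa := fun w => inord (minn (u c w) (size l)))) => k; last exact: measurable_nth_keys.
have := @measurable_b2r R _ T (fun w => inord (minn (u c w) (size l)) == k); apply.
by apply: (measurableT_comp (f := fun j => inord (minn j (size l)) == k) _ (mu c)).
Qed.

(** A call branches only on comparisons with the pivot. Freezing their outcomes as finite functions
    [L] and [M] makes the two sublists fixed lists of indices, to which the induction hypothesis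
    applies; hence the formulation over index lists. *)
Lemma measurable_qs_cost_rec (dep m : nat) (l : seq I) :
  measurable_fun setT (fun w => (qs_cost_rec dep (u^~ w) m [seq v i w | i <- l])%:R : R).
Proof.
elim: dep m l => [|dep IH] m l; first exact: measurable_cst.
have [/size0nil ->|l0] := posnP (size l); first exact: measurable_cst.
pose p w := nth 0 [seq v i w | i <- l] (u (size l) w).
have mp : measurable_fun setT p by exact: measurable_nth_pivot.
pose F (L M : {ffun I -> bool}) w : R :=
  (\sum_(i <- l) (v i w != p w)%:R * (beta (v i w) (p w))%:R) +
  (if (count L l).+1 == m then 0
   else if (m < (count L l).+1)%N then (qs_cost_rec dep (u^~ w) m [seq v i w | i <- [seq i <- l | L i]])%:R
   else (qs_cost_rec dep (u^~ w) (m - (count L l).+1) [seq v i w | i <- [seq i <- l | M i]])%:R).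
rewrite (_ : (fun w => _) = (fun w => F [ffun i => v i w < p w] [ffun i => p w < v i w] w)); last first.
  apply/funext => w; rewrite qs_cost_recS ?size_map// -/(p w).
  rewrite /F natrD natr_sum big_map big_mkcond/=; congr (_ + _).
    by apply: eq_bigr => i _; case: eqP; rewrite ?mul0r ?mul1r.
  have eL : (fun i => v i w < p w) =1 [ffun i => v i w < p w] by move=> i; rewrite ffunE.
  have eM : (fun i => p w < v i w) =1 [ffun i => p w < v i w] by move=> i; rewrite ffunE.
  rewrite count_map !filter_map/= (eq_count eL) (eq_filter eL) (eq_filter eM).
  by case: ifP => // _; case: ifP.
apply: (measurable_ffun_case (b := fun i w => v i w < p w)
  (F := fun L w => F L [ffun i => p w < v i w] w)) => [i|L].
  exact: measurable_fun_ltr.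
apply: (measurable_ffun_case (b := fun i w => p w < v i w)) => [i|M].
  exact: measurable_fun_ltr.
apply: measurable_funD; last first.
  case: ((count L l).+1 == m); first exact: measurable_cst.
  by case: (m < (count L l).+1)%N.
apply: measurable_sum => i; apply: measurable_funM.
  rewrite (_ : (fun w => _) = (fun w => 1 - (v i w == p w)%:R)).
    apply: measurable_funB; first exact: measurable_cst.
    by apply: measurable_b2r; exact: measurable_fun_eqr.
  by apply/funext => w; case: eqP; rewrite ?subrr ?subr0.
have mvp : measurable_fun setT (fun w => (v i w, p w)) by exact: measurable_fun_pair.
exact: (measurableT_comp (@measurable_beta R) mvp).
Qed.

End MeasurableCost.

(** * Order patterns of the remaining keys *)

Section OrderPatterns.
Variables (R : realType) (n m : nat).
Implicit Types (x y z : 'I_n) (L M : {set 'I_n}) (v : 'I_n -> R) (s t : R).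

Definition others x y : {set 'I_n} := [set z | (z != x) && (z != y)].

Definition pattern_itv L M s t z : interval R :=
  if z \in L then `]-oo, s[ else if z \in M then `]s, t[ else `]t, +oo[.

Definition pattern x y L M s t v : R :=
  \prod_(z in others x y) (v z \in pattern_itv L M s t z)%:R.

(** With the keys of [L] below [s] and those of [M] between the levels, keys at [s] and [t] have
    ranks [#|L| + 1] and [#|L| + #|M| + 2]. *)
Definition pattern_weight L M : R := rank_weight R m #|L|.+1 (#|L| + #|M|).+2.

(** The rank weight with the levels separated from the remaining keys: at fixed [s] and [t] each
    term is a product over single keys, ready for independence. *)
Definition pattern_sum x y s t v : R :=
  \sum_(L : {set 'I_n} | L \subset others x y) \sum_(M : {set 'I_n} | M \subset others x y :\: L)
    pattern_weight L M * pattern x y L M s t v.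

Lemma card_others x y : x != y -> #|others x y| = n.-2.
Proof.
move=> xy; have E : others x y = ~: [set x; y] by apply/setP => z; rewrite !inE negb_or.
by rewrite E cardsCs finset.setCK cards2 xy card_ord subn2.
Qed.

Lemma pattern_eq0 x y L M s t v z : z \in others x y ->
  v z \notin pattern_itv L M s t z -> pattern x y L M s t v = 0.
Proof. by move=> zo vz; rewrite /pattern (bigD1 z)//= (negbTE vz) mul0r. Qed.

(* Exactly one pair [(L, M)] contributes: the sets of keys below [v x] and between
   [v x] and [v y]. *)
Lemma pattern_sumE x y v : injective v -> v x < v y ->
  pattern_sum x y (v x) (v y) v =
  rank_weight R m (rank [seq v i | i : 'I_n] (v x)) (rank [seq v i | i : 'I_n] (v y)).
Proof.
move=> vI xy.
have xyn : x != y by apply: contraTneq xy => ->; rewrite ltxx.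
pose L0 : {set 'I_n} := [set z | v z < v x]%SET.
pose M0 : {set 'I_n} := [set z | v x < v z < v y]%SET.
have L0o : L0 \subset others x y.
  apply/fintype.subsetP => z; rewrite !inE => zx.
  by apply/andP; split; apply: contraTneq zx => ->; rewrite ?ltxx// ltNge ltW.
have M0o : M0 \subset others x y :\: L0.
  apply/fintype.subsetP => z; rewrite !inE => /andP[xz zy].
  rewrite -leNgt (ltW xz)/=.
  by apply/andP; split; [apply: contraTneq xz|apply: contraTneq zy] => ->; rewrite ltxx.
have rk w : rank [seq v i | i : 'I_n] (v w) = #|[set z | v z < v w]%SET|.+1.
  rewrite /rank; congr _.+1; rewrite count_map -size_filter cardE /enum_mem.
  rewrite -filter_predI; congr size; apply: eq_filter => z /=.
  by rewrite andbT [RHS]inE.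
have rx : rank [seq v i | i : 'I_n] (v x) = #|L0|.+1 by rewrite rk.
have ry : rank [seq v i | i : 'I_n] (v y) = (#|L0| + #|M0|).+2.
  rewrite rk; congr _.+1.
  have -> : [set z | v z < v y]%SET = x |: (L0 :|: M0).
    apply/setP => z; rewrite !inE; case: (ltgtP (v z) (v x)) => [zx|xz|/vI ->].
    - by rewrite orbT (lt_trans zx).
    - by case: eqVneq => [zx|//]; rewrite zx ltxx in xz.
    - by rewrite eqxx xy.
  rewrite cardsU1 !inE ltxx/= add1n; congr _.+1.
  rewrite cardsU (_ : L0 :&: M0 = finset.set0) ?cards0 ?subn0//.
  by apply/setP => z; rewrite !inE; case: (ltgtP (v z) (v x)).
rewrite rx ry /pattern_sum (bigD1 L0)//= (bigD1 M0)//=.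
rewrite [X in _ + X + _]big1 => [|M /andP[MK MM0]]; last first.
  apply/eqP; rewrite mulf_eq0; apply/orP; right; apply/eqP.
  have [z zM] : exists z, (z \in M) != (z \in M0).
    apply/existsP; apply: contraNT MM0 => /existsPn H; apply/eqP/setP => z.
    by apply/eqP; have := H z; rewrite negbK.
  have zK : z \in others x y :\: L0.
    move: zM; case: (boolP (z \in M)) => [/(fintype.subsetP MK)//|_].
    by case: (boolP (z \in M0)) => // /(fintype.subsetP M0o).
  move: zK; rewrite inE => /andP[zL0 zo]; apply: (pattern_eq0 (z := z)) => //.
  rewrite /pattern_itv (negbTE zL0); move: zM zL0; rewrite [z \in M0]inE [z \in L0]inE -leNgt.
  case: (z \in M); rewrite in_itv/=; first by move/negbTE => /=; case: (_ && _).
  rewrite andbT -leNgt eq_sym => + _; case: (ltgtP (v x) (v z)) => //= _.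
  by case: (ltgtP (v z) (v y)).
rewrite [X in _ + X]big1 => [|L /andP[LK LL0]]; last first.
  rewrite big1// => M MK; apply/eqP; rewrite mulf_eq0; apply/orP; right; apply/eqP.
  have [z zL] : exists z, (z \in L) != (z \in L0).
    apply/existsP; apply: contraNT LL0 => /existsPn H; apply/eqP/setP => z.
    by apply/eqP; have := H z; rewrite negbK.
  have zo : z \in others x y.
    move: zL; case: (boolP (z \in L)) => [/(fintype.subsetP LK)//|_].
    by case: (boolP (z \in L0)) => // /(fintype.subsetP L0o).
  apply: (pattern_eq0 (z := z)) => //; rewrite /pattern_itv; move: zL; rewrite [z \in L0]inE.
  case: (z \in L); first by rewrite in_itv/=; case: (_ < _).
  case: ltP => // zx _; case: (z \in M); rewrite in_itv/= ?andbT -?leNgt.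
    by rewrite negb_and -leNgt ltW.
  by rewrite ltW// (lt_trans zx).
rewrite !addr0 /pattern_weight /pattern big1 ?mulr1// => z.
rewrite inE /pattern_itv [z \in L0]inE [z \in M0]inE => /andP[zx zy].
case: (ltgtP (v z) (v x)) => [zvx|xvz|/vI E]; last by rewrite E eqxx in zx.
  by rewrite in_itv/= zvx.
case: (ltgtP (v z) (v y)) => [zvy|yvz|/vI E]; last by rewrite E eqxx in zy.
  by rewrite in_itv/= xvz zvy.
by rewrite in_itv/= yvz.
Qed.

Lemma expected_cost_pattern v : injective v ->
  expected_cost m [seq v i | i : 'I_n] =
  \sum_x \sum_(y | y != x)
    (v x < v y)%R%:R * (beta (v x) (v y))%:R * pattern_sum x y (v x) (v y) v.
Proof.
move=> vI; rewrite /expected_cost big_image/=; apply: eq_bigr => x _.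
rewrite big_image_cond/= [RHS]big_mkcond [LHS]big_mkcond; apply: eq_bigr => y _ /=.
have [->|yx] := eqVneq y x; first by rewrite ltxx.
by case: ifPn => xy; rewrite ?mul0r// pattern_sumE// mul1r.
Qed.

(** For [s < t] in the unit interval, the mean of [pattern_sum] over [n - 2] further uniform keys,
    [a] of them below [s] and [b] between [s] and [t]. *)
Definition pattern_poly s t : R :=
  \sum_(a < n.-1) \sum_(b < (n.-2 - a).+1) ('C(n.-2, a) * 'C(n.-2 - a, b))%:R *
    (rank_weight R m a.+1 (a + b).+2 * (s ^+ a * (t - s) ^+ b * (1 - t) ^+ (n.-2 - a - b))).

Lemma sum_subset_card (K : {set 'I_n}) (f : nat -> R) :
  \sum_(L : {set 'I_n} | L \subset K) f #|L| = \sum_(a < #|K|.+1) 'C(#|K|, a)%:R * f a.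
Proof.
rewrite (partition_big (fun L : {set 'I_n} => inord #|L| : 'I_#|K|.+1) xpredT)//=.
apply: eq_bigr => a _.
rewrite (eq_bigl (fun L : {set 'I_n} => L \in [set L : {set 'I_n} | (L \subset K) && (#|L| == a)]%SET)); last first.
  move=> L; rewrite inE; case: (boolP (L \subset K)) => //= LK.
  by rewrite -val_eqE/= inordK// ltnS subset_leq_card.
rewrite (eq_bigr (fun=> f a)) => [|L]; last by rewrite inE => /andP[_ /eqP ->].
by rewrite sumr_const cards_draws mulr_natl.
Qed.

Lemma pattern_polyE x y s t : x != y -> (1 < n)%N ->
  \sum_(L : {set 'I_n} | L \subset others x y) \sum_(M : {set 'I_n} | M \subset others x y :\: L)
    pattern_weight L M * \prod_(z in others x y)
      (if z \in L then s else if z \in M then t - s else 1 - t) =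
  pattern_poly s t.
Proof.
move=> xy n1; have cK := card_others xy.
pose g a b := rank_weight R m a.+1 (a + b).+2 * (s ^+ a * (t - s) ^+ b * (1 - t) ^+ (n.-2 - a - b)).
transitivity (\sum_(L : {set 'I_n} | L \subset others x y) \sum_(b < (n.-2 - #|L|).+1)
   'C(n.-2 - #|L|, b)%:R * g #|L| b).
  apply: eq_bigr => L LK.
  have cKL : #|others x y :\: L| = (n.-2 - #|L|)%N.
    by rewrite cardsD cK; congr (_ - _)%N; congr #|pred_of_set _|; apply/finset.setIidPr.
  rewrite -cKL -(sum_subset_card _ (g #|L|)); apply: eq_bigr => M MK.
  rewrite /g; congr (_ * _).
  rewrite (bigID (mem L))/= (bigID (mem M) (fun i => _ && (i \notin L)))/= -mulrA.
  congr (_ * (_ * _)).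
  - rewrite (eq_bigr (fun=> s)) => [|z /andP[_ ->]//]; rewrite prodr_const.
    congr (_ ^+ _); apply: eq_card => z; rewrite unfold_in /=.
    by case: (boolP (z \in L)) => [/(fintype.subsetP LK) ->|]; rewrite ?andbF.
  - rewrite (eq_bigr (fun=> t - s)) => [|z /andP[/andP[_ /negbTE ->] ->]//].
    rewrite prodr_const; congr (_ ^+ _); apply: eq_card => z; rewrite unfold_in /=.
    case: (boolP (z \in M)) => [/(fintype.subsetP MK)|]; rewrite ?andbF// inE.
    by move=> /andP[-> ->].
  - rewrite (eq_bigr (fun=> 1 - t)) => [|z /andP[/andP[_ /negbTE ->] /negbTE ->]//].
    rewrite prodr_const; congr (_ ^+ _).
    rewrite (_ : (_ - #|M|)%N = #|others x y :\: L :\: M|); last first.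
      by rewrite -cKL [RHS]cardsD (finset.setIidPr MK).
    by apply: eq_card => z; rewrite unfold_in /= [RHS]inE [z \in _ :\: L]inE andbC; congr (_ && _); rewrite andbC.
rewrite (sum_subset_card _ (fun a => \sum_(b < (n.-2 - a).+1) 'C(n.-2 - a, b)%:R * g a b)) cK.
rewrite /pattern_poly prednK; last by lia.
apply: eq_bigr => a _; rewrite mulr_sumr; apply: eq_bigr => b _.
by rewrite natrM mulrA.
Qed.

(** Put [i = a + 1] and [j = a + b + 2]: the factor [n (n - 1)] completes the trinomial in [n - 2]
    to [multinom]. The cases [m <= i], [i < m < j] and [j <= m] of [rank_weight] are the indicators
    of the three [C1]. *)
Lemma pattern_poly_Pq s t : (1 < n)%N -> (0 < m <= n)%N ->
  (n * n.-1)%:R * pattern_poly s t = Pq 1 m n s t + Pq 2 m n s t + Pq 3 m n s t.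
Proof.
move=> n1 /andP[m0 mn].
transitivity (\sum_(1 <= i < n.+1) \sum_(i.+1 <= j < n.+1)
  rank_weight R m i j * multinom R n i j * s ^+ i.-1 * (t - s) ^+ (j - i).-1 * (1 - t) ^+ (n - j)); last first.
  rewrite -!big_split/= big_nat [RHS]big_nat; apply: eq_bigr => i ii.
  rewrite -!big_split/= big_nat [RHS]big_nat; apply: eq_bigr => j jj.
  rewrite -!mulrDl; congr (_ * _ * _ * _ * _); rewrite /rank_weight.
  rewrite (_ : [&& (0 < m <= i)%N, (i < j)%N & (j <= n)%N] = (m <= i)%N); last by lia.
  rewrite (_ : [&& (0 < i < m)%N, (m < j)%N & (j <= n)%N] = (i < m)%N && (m < j)%N); last by lia.
  rewrite (_ : [&& (0 < i < j)%N, (j <= m)%N & (m <= n)%N] = (j <= m)%N); last by lia.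
  have [mi|im] := leqP m i.
    rewrite (_ : (j <= m)%N = false); last by lia.
    by rewrite mul1r !mul0r !addr0; congr (_ / _%:R); lia.
  by have [jm|mj] := leqP j m; rewrite mul1r !mul0r ?add0r ?addr0; congr (_ / _%:R); lia.
rewrite big_add1/= big_mkord /pattern_poly mulr_sumr.
have -> : n = n.-1.+1 by lia.
rewrite big_ord_recr/= big_geq ?addr0//; apply: eq_bigr => a _.
have ha := ltn_ord a.
rewrite (_ : \sum_(a.+2 <= j < _) _ = \sum_(0 <= b < (n.-2 - a).+1)
   rank_weight R m a.+1 (b + a.+2) * multinom R n a.+1 (b + a.+2) * s ^+ a *
   (t - s) ^+ (b + a.+2 - a.+1).-1 * (1 - t) ^+ (n - (b + a.+2))); last first.
  rewrite -{1}[a.+2]add0n big_addn (_ : n.-1.+2 - a.+2 = (n.-2 - a).+1)%N; last by lia.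
  by rewrite (_ : n.-1.+1 = n)//; lia.
rewrite big_mkord mulr_sumr; apply: eq_bigr => b _; have hb := ltn_ord b.
rewrite /multinom (_ : (b + a.+2 - a.+1).-1 = b); last by lia.
rewrite (_ : n - (b + a.+2) = n.-2 - a - b)%N; last by lia.
rewrite (_ : (b + a.+2)%N = (a + b).+2); last by lia.
have /(congr1 (fun k => k%:R : R)) : (n * n.-1 * ('C(n.-2, a) * 'C(n.-2 - a, b)) *
    (a`! * b`! * (n.-2 - a - b)`!) = n`!)%N.
  have E1 : ('C(n.-2, a) * (a`! * (n.-2 - a)`!) = (n.-2)`!)%N by apply: bin_fact; lia.
  have E2 : ('C(n.-2 - a, b) * (b`! * (n.-2 - a - b)`!) = (n.-2 - a)`!)%N by apply: bin_fact; lia.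
  have -> : n`! = (n * n.-1 * (n.-2)`!)%N.
    by case: (n) n1 => [|[|k]]// _; rewrite !factS mulnA.
  by rewrite -E1 -E2; ring.
rewrite !natrM => E.
have F0 : (a`!%:R * b`!%:R * (n.-2 - a - b)`!%:R) != 0 :> R.
  by rewrite !mulf_neq0// pnatr_eq0 -lt0n fact_gt0.
rewrite -[n`!%:R]E mulfK// (_ : n.-1.+1 = n)%N; last by lia.
move: (rank_weight _ _ _ _) ((1 - t) ^+ (n.-2 - _ - _)) ((t - s) ^+ b) (s ^+ a)
  (n%:R : R) (n.-1%:R : R) ('C(_, _)%:R : R) ('C(n.-2, a)%:R : R) => *; ring.
Qed.

End OrderPatterns.

(** * Separating blocks of random variables *)

Section BlockFubini.
Context d (T : measurableType d) (R : realType) (P : probability T R).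
Variables (I : finType) (G : I -> set (set T)).
Hypothesis Gm : forall i A, G i A -> measurable A.
Hypothesis GT : forall i, G i setT.
Hypothesis GI : forall i, setI_closed (G i).
Hypothesis indep : mutually_independent P G.

Local Notation TJ J := (g_sigma_algebraType (rects G J)).

(** The two identity maps from [T] to [TJ J1] and [TJ J2] play [Y] and [Z] of [indep_fubini]. Joint
    measurability of [phi] expresses that its arguments are seen only through the blocks [J1] and
    [J2]. *)
Lemma block_fubini (J1 J2 : {set I}) (phi : TJ J1 * TJ J2 -> \bar R) :
  (forall i, i \in J1 -> i \notin J2) ->
  measurable_fun setT phi -> (forall z, 0 <= phi z)%E ->
  (\int[P]_w phi (w, w) = \int[P]_w1 \int[P]_w2 phi (w1, w2))%E.
Proof.
move=> J12 mphi phi0.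
have mid J : measurable_fun setT (fun w : T => w : TJ J).
  by move=> _ B sB; rewrite setTI; exact: (sigma_rects_measurable Gm sB).
pose Y : {mfun T >-> TJ J1} := HB.pack (fun w : T => w : TJ J1)
  (isMeasurableFun.Build _ _ _ _ _ (mid J1)).
pose Z : {mfun T >-> TJ J2} := HB.pack (fun w : T => w : TJ J2)
  (isMeasurableFun.Build _ _ _ _ _ (mid J2)).
apply: (indep_fubini (Y := Y) (Z := Z)) => // A B mA mB.
exact: (sigma_rects_indep Gm GT GI indep J12 mA mB).
Qed.

End BlockFubini.

Section MeasurablePattern.
Context (R : realType) d (T : measurableType d) (n m : nat) (x y : 'I_n).
Variables (a b : T -> R) (v : 'I_n -> T -> R).
Hypotheses (ma : measurable_fun setT a) (mb : measurable_fun setT b).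
Hypothesis mv : forall z, z \in others x y -> measurable_fun setT (v z).

(** Measurability is asked of the keys in [others x y] only, because the lemma is also applied on
    sigma-algebras from which the key [x] or [y] has been removed. *)
Lemma measurable_pattern_sum :
  measurable_fun setT (fun w => pattern_sum m x y (a w) (b w) (v^~ w)).
Proof.
rewrite /pattern_sum.
rewrite (_ : (fun w => _) = (fun w => \sum_(L : {set 'I_n}) if L \subset others x y then
  \sum_(M : {set 'I_n}) if M \subset others x y :\: L then
    pattern_weight R m L M * pattern x y L M (a w) (b w) (v^~ w) else 0 else 0)); last first.
  by apply/funext => w; rewrite big_mkcond; apply: eq_bigr => L _; case: ifP => // _; exact: big_mkcond.
apply: measurable_sum => L; case: (L \subset _); last exact: measurable_cst.
apply: measurable_sum => M; case: (M \subset _); last exact: measurable_cst.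
apply: measurable_funM; first exact: measurable_cst.
rewrite /pattern.
rewrite (_ : (fun w => _) = (fun w => \prod_(z : 'I_n) if z \in others x y then
   (v z w \in pattern_itv L M (a w) (b w) z)%:R else 1)); last first.
  by apply/funext => w; rewrite big_mkcond.
apply: measurable_prod => z _; case: (boolP (z \in others x y)) => [zo|_]; last exact: measurable_cst.
apply: measurable_b2r; rewrite /pattern_itv; have mz := mv zo.
case: (z \in L).
  rewrite (_ : (fun w => _) = (fun w => v z w < a w)); first exact: measurable_fun_ltr.
  by apply/funext => w; rewrite in_itv.
case: (z \in M).
  rewrite (_ : (fun w => _) = (fun w => (a w < v z w) && (v z w < b w))).
    by apply: measurable_and; exact: measurable_fun_ltr.
  by apply/funext => w; rewrite in_itv.
rewrite (_ : (fun w => _) = (fun w => b w < v z w)); first exact: measurable_fun_ltr.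
by apply/funext => w; rewrite in_itv/= andbT.
Qed.

Lemma measurable_pair_cost : measurable_fun setT (fun w =>
  (a w < b w)%R%:R * (beta (a w) (b w))%:R * pattern_sum m x y (a w) (b w) (v^~ w)).
Proof.
apply: measurable_funM; last exact: measurable_pattern_sum.
apply: measurable_funM; first by apply: measurable_b2r; exact: measurable_fun_ltr.
have mab : measurable_fun setT (fun w => (a w, b w)) by exact: measurable_fun_pair.
exact: (measurableT_comp (@measurable_beta R) mab).
Qed.

End MeasurablePattern.

Lemma pattern_sum_ge0 (R : realType) n m (x y : 'I_n) (s t : R) v :
  0 <= pattern_sum m x y s t v.
Proof.
apply: sumr_ge0 => L _; apply: sumr_ge0 => M _; rewrite mulr_ge0//.
  by rewrite /pattern_weight /rank_weight divr_ge0.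
by apply: prodr_ge0.
Qed.

(** * Integration over the keys and the pivot choices *)

Section ExpectedBitComparisons.
Context d (T : measurableType d) (R : realType) (P : probability T R) (n m : nat).
Variables (X : 'I_n -> {RV P >-> R}) (U : nat -> {RV P >-> nat}).
Hypotheses (n2 : (2 <= n)%N) (mn : (1 <= m <= n)%N).
Hypothesis unifX : forall (i : 'I_n) (A : set R), measurable A ->
  distribution P (X i) A = uniform_prob (@ltr01 R) A.
Hypothesis unifU : forall c k : nat, (k < c <= n)%N ->
  P (U c @^-1` [set k]) = (c%:R^-1)%:E.
Hypothesis indep : mutually_independent P (key_pivot_events X U).

Local Notation G := (key_pivot_events X U).
Local Notation unif := (uniform_prob (@ltr01 R)).

Let Gm i A : G i A -> measurable A.
Proof.
by case: i => i [B mB <-]; rewrite setTI -[X in measurable X]setTI; exact: measurable_funPT.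
Qed.

Let GT i : G i setT.
Proof. by case: i => i; exists setT => //; rewrite preimage_setT setTI. Qed.

Let GI i : setI_closed (G i).
Proof.
case: i => i _ _ [A mA <-] [B mB <-]; exists (A `&` B); rewrite ?preimage_setI ?setTI//;
  exact: measurableI.
Qed.

Let mX (J : {set 'I_n + 'I_n}) i : inl i \in J ->
  measurable_fun setT (X i : g_sigma_algebraType (rects G J) -> R).
Proof.
move=> iJ _ B mB; rewrite setTI; apply: sub_sigma_algebra.
by apply: (rects1 GT iJ); exists B => //; rewrite setTI.
Qed.

Let mU (J : {set 'I_n + 'I_n}) (c : 'I_n) : inr c \in J ->
  measurable_fun setT (U c.+1 : g_sigma_algebraType (rects G J) -> nat).
Proof.
move=> iJ _ B mB; rewrite setTI; apply: sub_sigma_algebra.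
by apply: (rects1 GT iJ); exists B => //; rewrite setTI.
Qed.

Lemma integral_key (i : 'I_n) (f : R -> \bar R) : measurable_fun setT f ->
  (forall s, 0 <= f s)%E -> (\int[P]_w f (X i w) = \int[unif]_s f s)%E.
Proof.
move=> mf f0.
have mXi : measurable_fun setT (X i : T -> measurableTypeR R).
  by move=> _ B mB; exact: (measurable_funP (X i) measurableT B mB).
pose Y : {mfun T >-> measurableTypeR R} := HB.pack (X i : T -> measurableTypeR R)
  (isMeasurableFun.Build _ _ _ _ _ mXi).
transitivity (\int[distribution P Y]_s f s)%E.
  by rewrite ge0_integral_distribution.
by apply: (@eq_measure_integral _ _ _ _ unif (distribution P Y)) => A mA _; exact: unifX.
Qed.

Lemma integral_uniform_itv (f : R -> \bar R) : measurable_fun setT f ->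
  (forall s, 0 <= f s)%E ->
  (\int[unif]_s f s = \int[lebesgue_measure]_(s in `]0%R, 1%R[) f s)%E.
Proof.
move=> mf f0; rewrite integral_uniform// subr0 invr1 mul1e.
rewrite -integral_itv_obnd_cbnd; last exact: measurable_funTS.
by rewrite -integral_itv_bndo_bndc//; exact: measurable_funTS.
Qed.

Local Notation rest x := (g_sigma_algebraType (rects G (~: [set inl x]))).

(* A key is independent of the sigma-algebra generated by the other keys and the pivots. *)
Lemma key_fubini (x : 'I_n) (f : R * rest x -> \bar R) : measurable_fun setT f ->
  (forall z, 0 <= f z)%E ->
  (\int[P]_w f (X x w, w) = \int[unif]_s \int[P]_w f (s, w))%E.
Proof.
move=> mf f0.
have xJ : inl x \in [set (inl x : 'I_n + 'I_n)]%SET by rewrite inE.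
pose phi (z : g_sigma_algebraType (rects G [set inl x]%SET) * rest x) := f (X x z.1, z.2).
transitivity (\int[P]_w phi (w, w))%E => //.
rewrite (block_fubini Gm GT GI indep)//.
- rewrite -(@integral_key x (fun s => \int[P]_w f (s, w))%E)//; last by move=> s; exact: integral_ge0.
  have mf' : measurable_fun setT (f : R * T -> \bar R).
    have mid : measurable_fun setT (fun z : R * T => (z.1, z.2 : rest x)).
      apply: measurable_fun_pair; first exact: measurable_fst.
      have m2 : measurable_fun setT (fun w : T => w : rest x).
        by move=> _ B sB; rewrite setTI; exact: (sigma_rects_measurable Gm sB).
      exact: (measurableT_comp m2 measurable_snd).
    rewrite (_ : (f : R * T -> \bar R) = f \o (fun z : R * T => (z.1, z.2 : rest x))).
      exact: (measurableT_comp mf mid).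
    by apply/funext => -[].
  exact: (measurable_fun_fubini_tonelli_F (m2 := P) (f : R * T -> \bar R) mf' f0).
- by move=> i; rewrite !inE negbK.
- apply: (measurableT_comp mf).
  apply: measurable_fun_pair; last exact: measurable_snd.
  exact: (measurableT_comp (mX xJ) measurable_fst).
- by move=> z; exact: f0.
Qed.

Let mXrest x z : z != x -> measurable_fun setT (fun w : R * rest x => X z w.2).
Proof.
move=> zx; have zJ : inl z \in ~: [set (inl x : 'I_n + 'I_n)].
  by rewrite !inE; apply: contra_neq zx => -[].
exact: (measurableT_comp (mX zJ) measurable_snd).
Qed.

(** Once [X x] is separated as a value [s], the event reads [X y = s], which is null since the
    uniform law is dominated by Lebesgue measure. *)
Lemma key_neq_ae (x y : 'I_n) : x != y -> {ae P, forall w, X x w != X y w}.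
Proof.
move=> xy.
have mE : measurable [set w | X x w == X y w].
  rewrite -[X in measurable X]setTI.
  exact: (@measurable_fun_eqr _ _ _ setT (X x) (X y) _ _ measurableT [set true]).
suff E0 : P [set w | X x w == X y w] = 0%E.
  by exists [set w | X x w == X y w]; split => // w /= /negP; rewrite negbK.
have E (s : R) (z : 'I_n) (h : T -> R) : measurable [set w | h w == X z w] ->
    P [set w | h w == X z w] = (\int[P]_w (h w == X z w)%:R%:E)%E.
  move=> mh; rewrite -[LHS]mul1e -integral_cst// [LHS]integral_mkcond; apply: eq_integral => w _.
  rewrite patchE (_ : (w \in _) = (h w == X z w)); first by case: eqP.
  by apply/idP/idP; rewrite inE.
rewrite (E 0)//.
pose f (z : R * rest x) : \bar R := (z.1 == X y z.2)%:R%:E.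
rewrite (@key_fubini x f)//.
- rewrite integral0_eq// => s _; rewrite -(E 0)//; last first.
    rewrite -[X in measurable X]setTI.
    by apply: (@measurable_fun_eqr _ _ _ setT (cst s) (X y) _ _ measurableT [set true]).
  rewrite (_ : [set w | _] = X y @^-1` [set s]); last first.
    by apply/seteqP; split => w /=; [move=> /eqP ->|move=> ->].
  have := unifX y (measurable_set1 s); rewrite /distribution/= /pushforward => ->.
  have /null_content_dominatesP D := dominates_uniform_prob (@ltr01 R).
  by apply: D => //; exact: lebesgue_measure_set1.
- apply/measurable_EFinP; apply: measurable_b2r; apply: measurable_fun_eqr.
    exact: measurable_fst.
  by apply: mXrest; rewrite eq_sym.
- by move=> z; rewrite lee_fin.
Qed.

Lemma keys_injective_ae : {ae P, forall w, injective (fun i => X i w)}.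
Proof.
have : {ae P, forall w, forall x y : 'I_n, x != y -> X x w != X y w}.
  apply: filter_forall => x; apply: filter_forall => y.
  have [->|xy] := eqVneq x y; first exact: aeW.
  by apply: filterS (key_neq_ae xy) => w.
by apply: filterS => w H x y; apply: contra_eq => /H.
Qed.

Definition pair_cost (x y : 'I_n) (s t : R) (v : 'I_n -> R) : R :=
  (s < t)%R%:R * (beta s t)%:R * pattern_sum m x y s t v.

Lemma pair_cost_ge0 x y s t v : 0 <= pair_cost x y s t v.
Proof. by rewrite /pair_cost !mulr_ge0// pattern_sum_ge0. Qed.

(** [key_fubini] frees [X x] and then [X y]. It applies because [pattern_sum] reads the keys in
    [others x y] only, the two chosen ones entering through [s] and [t]. *)
Lemma integral_pair_cost_uniform (x y : 'I_n) : x != y ->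
  (\int[P]_w (pair_cost x y (X x w) (X y w) (fun z => X z w))%:E =
   \int[unif]_s \int[unif]_t \int[P]_w (pair_cost x y s t (fun z => X z w))%:E)%E.
Proof.
move=> xy.
pose f (z : R * rest x) : \bar R := (pair_cost x y z.1 (X y z.2) (fun i => X i z.2))%:E.
rewrite (@key_fubini x f)//.
- apply: eq_integral => s _.
  pose g (z : R * rest y) : \bar R := (pair_cost x y s z.1 (fun i => X i z.2))%:E.
  rewrite (@key_fubini y g)// => [|z]; last by rewrite lee_fin pair_cost_ge0.
  apply/measurable_EFinP; apply: measurable_pair_cost => //.
  by move=> z; rewrite inE => /andP[_ zy]; exact: mXrest.
- apply/measurable_EFinP; apply: measurable_pair_cost => //.
  + by apply: mXrest; rewrite eq_sym.
  + by move=> z; rewrite inE => /andP[zx _]; exact: mXrest.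
- by move=> z; rewrite lee_fin pair_cost_ge0.
Qed.

Lemma uniform_prob_setI (A : set (measurableTypeR R)) : measurable A ->
  unif A = lebesgue_measure (A `&` `[0, 1]).
Proof.
move=> mA; rewrite -[LHS]mul1e -integral_cst// [LHS]integral_mkcond.
rewrite integral_uniform; last 2 first.
- by apply/(measurable_restrictT _ mA); exact: measurable_cst.
- by move=> s; rewrite patchE; case: ifP.
by rewrite subr0 invr1 mul1e -integral_mkcondr integral_cst ?mul1e 1?setIC//; exact: measurableI.
Qed.

Definition pattern_len (L M : {set 'I_n}) (s t : R) (z : 'I_n) : R :=
  if z \in L then s else if z \in M then t - s else 1 - t.

Lemma key_pattern_itv L M (s t : R) z : 0 <= s -> s < t -> t <= 1 ->
  P (X z @^-1` [set` pattern_itv L M s t z]) = (pattern_len L M s t z)%:E.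
Proof.
move=> s0 st t1.
have := unifX z (@measurable_itv R (pattern_itv L M s t z)); rewrite /distribution/= /pushforward => ->.
rewrite uniform_prob_setI; last exact: measurable_itv.
rewrite /pattern_itv /pattern_len; case: (z \in L); [|case: (z \in M)].
- rewrite (_ : _ `&` _ = `[0, s[%classic).
    rewrite lebesgue_measure_itv/= lte_fin oppr0 adde0; case: ltP => // s0'.
    by congr (_%:E); apply/eqP; rewrite eq_le s0' s0.
  apply/seteqP; split => u /=; rewrite !in_itv/=; first by move=> [-> /andP[-> _]].
  move=> /andP[u0 us]; split => //; rewrite u0/=; lra.
- rewrite (_ : _ `&` _ = `]s, t[%classic).
    by rewrite lebesgue_measure_itv/= lte_fin st EFinB.
  apply/seteqP; split => u /=; rewrite !in_itv/=; first by move=> [-> _].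
  by move=> /andP[su ut]; rewrite su ut; split => //; lra.
- rewrite (_ : _ `&` _ = `]t, 1]%classic).
    rewrite lebesgue_measure_itv/= lte_fin EFinB; case: ltP => // t1'.
    by rewrite (_ : t = 1) ?subee//; apply/eqP; rewrite eq_le t1 t1'.
  apply/seteqP; split => u /=; rewrite !in_itv/= ?andbT; first by move=> [-> /andP[_ ->]].
  by move=> /andP[tu u1]; rewrite tu u1 andbT; split => //; lra.
Qed.

Lemma measurable_pattern x y L M (s t : R) :
  measurable_fun setT (fun w => pattern x y L M s t (fun z => X z w)).
Proof.
rewrite /pattern.
rewrite (_ : (fun w => _) = (fun w => \prod_(z : 'I_n) if z \in others x y then
   (X z w \in pattern_itv L M s t z)%:R else 1)); last first.
  by apply/funext => w; rewrite big_mkcond.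
apply: measurable_prod => z _; case: (z \in others x y); last exact: measurable_cst.
by apply: (measurableT_comp (measurable_mem_itv _ measurableT)).
Qed.

(** [pattern] is the indicator of an intersection of events, one for each remaining key, so mutual
    independence gives a product of interval lengths. *)
Lemma integral_pattern x y L M (s t : R) : 0 <= s -> s < t -> t <= 1 ->
  (\int[P]_w (pattern x y L M s t (fun z => X z w))%:E =
   (\prod_(z in others x y) pattern_len L M s t z)%:E)%E.
Proof.
move=> s0 st t1.
pose J : {set 'I_n + 'I_n} := [set inl z | z in others x y]%SET.
pose E (i : 'I_n + 'I_n) : set T :=
  if i is inl z then X z @^-1` [set` pattern_itv L M s t z] else setT.
have GE i : i \in J -> G i (E i).
  case: i => [z|c] _; last exact: GT.
  by exists [set` pattern_itv L M s t z]; [exact: measurable_itv|rewrite setTI].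
have JE : (\prod_(i in J) P (E i) = (\prod_(z in others x y) pattern_len L M s t z)%:E)%E.
  rewrite big_imset/= => [|z z' _ _ []//]; rewrite -prodEFin.
  by apply: eq_bigr => z _; exact: key_pattern_itv.
rewrite -JE -(indep GE) -[RHS]mul1e -integral_cst//; last first.
  by apply: fin_bigcap_measurable => // i /GE /Gm.
rewrite [RHS]integral_mkcond; apply: eq_integral => w _; rewrite patchE.
case: ifPn; rewrite ?inE ?notin_setE => wE.
  rewrite /pattern big1// => z zo; have /= := wE (inl z) (imset_f _ zo).
  by move=> ->.
congr (_%:E); apply/eqP; apply: contra_notT wE => p0 i /= /imsetP[z zo ->] /=.
apply: contraNT p0 => Xz; apply/eqP.
exact: (pattern_eq0 (v := fun z => X z w) zo Xz).
Qed.

Lemma integral_sum_EFin (K : finType) (Q : pred K) (f : K -> T -> R) (c : K -> R) :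
  (forall k, Q k -> measurable_fun setT (f k)) -> (forall k w, Q k -> 0 <= f k w) ->
  (forall k, Q k -> \int[P]_w (f k w)%:E = (c k)%:E)%E ->
  (\int[P]_w (\sum_(k | Q k) f k w)%:E = (\sum_(k | Q k) c k)%:E)%E.
Proof.
move=> mf f0 fc.
transitivity (\int[P]_w (\sum_(k : K) (if Q k then f k w else 0)%:E))%E.
  by apply: eq_integral => w _; rewrite sumEFin -big_mkcond.
rewrite ge0_integral_sum//.
- rewrite -sumEFin [RHS]big_mkcond; apply: eq_bigr => k _.
  by case: ifPn => [/fc//|_]; rewrite integral0.
- move=> k; apply/measurable_EFinP; case: (boolP (Q k)) => [/mf//|_].
  exact: measurable_cst.
- by move=> k w _; case: ifPn => [Qk|//]; rewrite lee_fin f0.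
Qed.

Lemma integral_pair_cost_pattern x y (s t : R) : x != y -> 0 <= s -> t <= 1 ->
  (\int[P]_w (pair_cost x y s t (fun z => X z w))%:E =
   ((s < t)%R%:R * (beta s t)%:R * pattern_poly n m s t)%:E)%E.
Proof.
move=> xy s0 t1; rewrite /pair_cost.
have [st|_] := ltP s t; last first.
  by under eq_integral do rewrite !mul0r; rewrite integral0 !mul0r.
have w0 L M : 0 <= pattern_weight R m L M by rewrite /pattern_weight /rank_weight divr_ge0.
have p0 L M w : 0 <= pattern x y L M s t (fun z => X z w) by exact: prodr_ge0.
under eq_integral do rewrite EFinM.
rewrite ge0_integralZl//; last 2 first.
- by apply/measurable_EFinP; apply: measurable_pattern_sum => // z _.
- by move=> w _; rewrite lee_fin pattern_sum_ge0.
rewrite [RHS]EFinM; congr (_ * _)%E; rewrite /pattern_sum -(pattern_polyE m _ _ xy)//.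
apply: integral_sum_EFin => [L _|L w _|L _].
- rewrite (_ : (fun w => _) = (fun w => \sum_(M : {set 'I_n}) if M \subset others x y :\: L then
    pattern_weight R m L M * pattern x y L M s t (fun z => X z w) else 0)); last first.
    by apply/funext => w; rewrite big_mkcond.
  apply: measurable_sum => M; case: (M \subset _); last exact: measurable_cst.
  by apply: measurable_funM; [exact: measurable_cst|exact: measurable_pattern].
- by apply: sumr_ge0 => M _; rewrite mulr_ge0.
apply: integral_sum_EFin => [M _|M w _|M _].
- by apply: measurable_funM; [exact: measurable_cst|exact: measurable_pattern].
- by rewrite mulr_ge0.
under eq_integral do rewrite EFinM.
have mp : measurable_fun setT (fun w => (pattern x y L M s t (fun z => X z w))%:E).
  by apply/measurable_EFinP; exact: measurable_pattern.
rewrite ge0_integralZl ?lee_fin//; first by rewrite integral_pattern.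
by move=> w _; rewrite lee_fin.
Qed.

Local Notation R' := (measurableTypeR R).

(** The uniform laws give the unit square, and the factor [s < t] of [pair_cost] cuts it down to the
    triangle. *)
Lemma integral_pair_cost (x y : 'I_n) : x != y ->
  (\int[P]_w (pair_cost x y (X x w) (X y w) (fun z => X z w))%:E =
   \int[lebesgue_measure]_(s in `]0%R, 1%R[) \int[lebesgue_measure]_(t in `]s, 1%R[)
     ((beta s t)%:R * pattern_poly n m s t)%:E)%E.
Proof.
move=> xy; rewrite integral_pair_cost_uniform//.
pose F (q : R' * R' * T) : \bar R := (pair_cost x y q.1.1 q.1.2 (fun z => X z q.2))%:E.
have mF : measurable_fun setT F.
  apply/measurable_EFinP; apply: measurable_pair_cost.
  - exact: (measurableT_comp measurable_fst measurable_fst).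
  - exact: (measurableT_comp measurable_snd measurable_fst).
  - by move=> z _; exact: (measurableT_comp _ measurable_snd).
have F0 q : (0 <= F q)%E by rewrite lee_fin pair_cost_ge0.
pose K (z : R' * R') : \bar R := (\int[P]_w F (z, w))%E.
have mK : measurable_fun setT K.
  exact: (measurable_fun_fubini_tonelli_F (m2 := P) F mF F0).
have K0 z : (0 <= K z)%E by exact: integral_ge0.
have mKs : measurable_fun setT (fun s : R' => \int[unif]_t K (s, t))%E.
  exact: (measurable_fun_fubini_tonelli_F (m2 := unif) K mK K0).
rewrite -[LHS]/(\int[unif]_s \int[unif]_t K (s, t))%E integral_uniform_itv//; last first.
  by move=> s; exact: integral_ge0.
apply: eq_integral => s; rewrite inE/= in_itv/= => /andP[s0 s1].
have mKt : measurable_fun setT (fun t : R' => K (s, t)).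
  exact: (measurableT_comp mK (measurable_pair1 s)).
rewrite integral_uniform_itv//.
rewrite [LHS]integral_mkcond [RHS]integral_mkcond; apply: eq_integral => t _.
rewrite !patchE (_ : (t \in `]0, 1[%classic) = (0 < t < 1)); last by apply/idP/idP; rewrite inE/= in_itv.
rewrite (_ : (t \in `]s, 1[%classic) = (s < t < 1)); last by apply/idP/idP; rewrite inE/= in_itv.
case: (ltP t 1) => t1; rewrite ?andbF ?andbT//.
have E : K (s, t) = ((s < t)%R%:R * (beta s t)%:R * pattern_poly n m s t)%:E.
  by apply: integral_pair_cost_pattern => //; exact: ltW.
case: (ltP s t) E => st E; first by rewrite (lt_trans s0 st) E mul1r.
by case: ifP => // _; rewrite E !mul0r.
Qed.

Let GU (c : 'I_n) k : G (inr c) (U c.+1 @^-1` [set k]).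
Proof. by exists [set k] => //; rewrite setTI. Qed.

(** The [c.+1] valid positions have mass [1 / (c+1)] each and so exhaust the total mass; this is how
    invalid positions, whose probabilities are not given, turn out to be null. *)
Lemma pivot_valid_prob (c : 'I_n) : P [set w | (U c.+1 w < c.+1)%N] = 1%E.
Proof.
have mUk k : measurable (U c.+1 @^-1` [set k]) by exact: Gm (GU c k).
rewrite (_ : [set w | _] = \big[setU/set0]_(k < c.+1) (U c.+1 @^-1` [set (k : nat)])).
  have tU : trivIset setT (fun k => U c.+1 @^-1` [set k]) by move=> i j _ _ [w [/= <- <-]].
  have /= -> := measure_bigsetU P mUk tU c.+1.
  rewrite (eq_bigr (fun=> (c.+1%:R^-1)%:E)) => [|k _]; last by rewrite unifU// (ltn_ord k) (ltn_ord c).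
  by rewrite sumEFin sumr_const card_ord -(mulr_natr (c.+1%:R^-1)) mulVf// pnatr_eq0.
rewrite -(bigcup_mkord c.+1 (fun k => U c.+1 @^-1` [set k])).
apply/seteqP; split => w /=; first by exists (U c.+1 w).
by move=> [k /= kc ->].
Qed.

Lemma pivot_valid_ae : {ae P, forall w, forall c : 'I_n, (U c.+1 w < c.+1)%N}.
Proof.
apply: filter_forall => c; exists (~` [set w | (U c.+1 w < c.+1)%N]).
have mA : measurable [set w | (U c.+1 w < c.+1)%N].
  rewrite (_ : [set w | _] = \bigcup_(k in `I_c.+1) (U c.+1 @^-1` [set k])).
    by apply: bigcup_measurable => k _; exact: Gm (GU c k).
  apply/seteqP; split => w /=; first by exists (U c.+1 w).
  by move=> [k /= kc ->].
split => //; first exact: measurableC.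
by rewrite probability_setC// pivot_valid_prob subee.
Qed.

Lemma pivot_prob (c k : 'I_n) : P (U c.+1 @^-1` [set (k : nat)]) = (pivot_weight R c k)%:E.
Proof.
rewrite /pivot_weight; case: leqP => kc; first by rewrite unifU// ltnS kc (ltn_ord c).
apply/eqP; rewrite -measure_le0.
have [N [mN N0 sN]] := pivot_valid_ae.
rewrite -N0; apply: le_measure; rewrite ?inE//; first exact: Gm (GU c k).
by move=> w /= Uk; apply: sN => /= /(_ c); rewrite Uk ltnS leqNgt kc.
Qed.

Definition pivot_event (g : {ffun 'I_n -> 'I_n}) (w : T) : R :=
  \prod_(c < n) (U c.+1 w == g c)%:R.

Lemma integral_pivot_event (g : {ffun 'I_n -> 'I_n}) :
  (\int[P]_w (pivot_event g w)%:E = (\prod_(c < n) pivot_weight R c (g c))%:E)%E.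
Proof.
pose J : {set 'I_n + 'I_n} := [set inr c | c in finset.setT]%SET.
pose E (i : 'I_n + 'I_n) : set T :=
  if i is inr c then U c.+1 @^-1` [set (g c : nat)] else setT.
have GE i : i \in J -> G i (E i).
  by case: i => [z|c] _; [exact: GT|exact: GU].
have JE : (\prod_(i in J) P (E i) = (\prod_(c < n) pivot_weight R c (g c))%:E)%E.
  rewrite big_imset/= => [|z z' _ _ []//]; rewrite -prodEFin.
  by apply: eq_big => [c|c _]; [rewrite inE|exact: pivot_prob].
rewrite -JE -(indep GE) -[RHS]mul1e -integral_cst//; last first.
  by apply: fin_bigcap_measurable => // i /GE /Gm.
rewrite [RHS]integral_mkcond; apply: eq_integral => w _; rewrite patchE.
case: ifPn; rewrite ?inE ?notin_setE => wE.
  rewrite /pivot_event big1// => c _; have /= -> := wE (inr c) (imset_f _ (finset.in_setT c)).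
  by rewrite eqxx.
congr (_%:E); apply/eqP; apply: contra_notT wE => p0 i /= /imsetP[c _ ->] /=.
apply/eqP; apply: contraNT p0 => Uc.
by rewrite /pivot_event (bigD1 c)//= (negbTE Uc) mul0r.
Qed.

Local Notation keys w := [seq X i w | i : 'I_n].

(** Exactly one table agrees with the realized positions. Since [pivots g] is 0 outside [1, ..., n],
    the function [F] must read only these entries. *)
Lemma sum_pivot_event (F : (nat -> nat) -> R) w :
  (forall u u', (forall c, (0 < c <= n)%N -> u c = u' c) -> F u = F u') ->
  (forall c : 'I_n, (U c.+1 w < c.+1)%N) ->
  \sum_(g : {ffun 'I_n -> 'I_n}) pivot_event g w * F (pivots g) = F (fun c => U c w).
Proof.
move=> HF Uw.
pose g0 : {ffun 'I_n -> 'I_n} := [ffun c : 'I_n => insubd c (U c.+1 w)].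
have g0E c : g0 c = U c.+1 w :> nat.
  by rewrite ffunE val_insubd (leq_trans (Uw c)) // ltn_ord.
rewrite (bigD1 g0)//= big1 ?addr0 => [|g gg0]; last first.
  have [c gc] : exists c, g c != g0 c.
    apply/existsP; apply: contraNT gg0 => /existsPn H; apply/eqP/ffunP => c.
    by have := H c; rewrite negbK => /eqP.
  by rewrite /pivot_event (bigD1 c)//= -g0E val_eqE eq_sym (negbTE gc) !mul0r.
rewrite /pivot_event big1 ?mul1r => [|c _]; last by rewrite g0E eqxx.
apply: HF => -[//|c] /andP[_ cn].
by rewrite -[c.+1]/(Ordinal cn).+1 pivots_ord g0E.
Qed.

Lemma measurable_pivot_event (J : {set 'I_n + 'I_n}) g : (forall c, inr c \in J) ->
  measurable_fun setT (pivot_event g : g_sigma_algebraType (rects G J) -> R).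
Proof.
move=> HJ; apply: measurable_prod => c _; apply: measurable_b2r.
exact: (measurableT_comp (f := fun k => k == g c :> nat) _ (mU (HJ c))).
Qed.

Definition pivot_cost (g : {ffun 'I_n -> 'I_n}) (w : T) : R :=
  (qs_cost_rec n (pivots g) m (keys w))%:R.

Lemma measurable_pivot_cost (J : {set 'I_n + 'I_n}) g : (forall i, inl i \in J) ->
  measurable_fun setT (pivot_cost g : g_sigma_algebraType (rects G J) -> R).
Proof.
move=> HJ; apply: (@measurable_qs_cost_rec R _ (g_sigma_algebraType (rects G J)) _
  (fun i w => X i w) (fun c _ => pivots g c)) => [i|c]; first exact: mX.
exact: measurable_cst.
Qed.

(** For a fixed table the cost depends on the keys alone and [pivot_event g] on the pivots alone.
    These blocks are independent, so the event may be replaced by its probability. *)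
Lemma integral_pivot_cost (g : {ffun 'I_n -> 'I_n}) :
  (\int[P]_w (pivot_event g w * pivot_cost g w)%:E =
   \int[P]_w ((\prod_(c < n) pivot_weight R c (g c)) * pivot_cost g w)%:E)%E.
Proof.
pose J1 : {set 'I_n + 'I_n} := [set inr c | c in finset.setT]%SET.
pose J2 : {set 'I_n + 'I_n} := [set inl i | i in finset.setT]%SET.
have HJ1 c : inr c \in J1 by apply: imset_f; rewrite finset.in_setT.
have HJ2 i : inl i \in J2 by apply: imset_f; rewrite finset.in_setT.
have W0 : 0 <= \prod_(c < n) pivot_weight R c (g c).
  by apply: prodr_ge0 => c _; rewrite /pivot_weight; case: ifP.
have C0 w : 0 <= pivot_cost g w by [].
have B0 w : 0 <= pivot_event g w by exact: prodr_ge0.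
have mC : measurable_fun setT (pivot_cost g).
  by apply: (@measurable_qs_cost_rec R _ T _ (fun i w => X i w) (fun c _ => pivots g c)) => [i|c].
pose phi (z : g_sigma_algebraType (rects G J1) * g_sigma_algebraType (rects G J2)) : \bar R :=
  (pivot_event g z.1 * pivot_cost g z.2)%:E.
rewrite -[LHS]/(\int[P]_w phi (w, w))%E (block_fubini Gm GT GI indep)//.
- have mB : measurable_fun setT (pivot_event g).
    apply: measurable_prod => c _; apply: measurable_b2r.
    exact: (measurableT_comp (f := fun k => k == g c :> nat) _ (measurable_funPT (U c.+1))).
  have mC' : measurable_fun setT (fun w => (pivot_cost g w)%:E) by apply/measurable_EFinP.
  have mB' : measurable_fun setT (fun w => (pivot_event g w)%:E) by apply/measurable_EFinP.
  have C0' w : (0 <= (pivot_cost g w)%:E)%E by rewrite lee_fin.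
  have B0' w : (0 <= (pivot_event g w)%:E)%E by rewrite lee_fin.
  transitivity (\int[P]_w1 ((pivot_event g w1)%:E * \int[P]_w (pivot_cost g w)%:E))%E.
    apply: eq_integral => w1 _; rewrite /phi/=; under eq_integral do rewrite EFinM.
    by rewrite ge0_integralZl.
  rewrite ge0_integralZr//; last by apply: integral_ge0.
  rewrite integral_pivot_event; under [RHS]eq_integral do rewrite EFinM.
  by rewrite ge0_integralZl// lee_fin.
- by move=> i /imsetP[c _ ->]; apply/negP => /imsetP[].
- apply/measurable_EFinP; apply: measurable_funM.
    exact: (measurableT_comp (measurable_pivot_event g HJ1) measurable_fst).
  exact: (measurableT_comp (measurable_pivot_cost g HJ2) measurable_snd).
- by move=> z; rewrite lee_fin mulr_ge0.
Qed.

Lemma integral_qs_cost :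
  (\int[P]_w ((qs_cost (fun c => U c w) m (keys w))%:R)%:E =
   \int[P]_w (\sum_x \sum_(y | y != x)
     pair_cost x y (X x w) (X y w) (fun z => X z w))%:E)%E.
Proof.
have W0 (g : {ffun 'I_n -> 'I_n}) : 0 <= \prod_(c < n) pivot_weight R c (g c).
  by apply: prodr_ge0 => c _; rewrite /pivot_weight; case: ifP.
have mC g : measurable_fun setT (pivot_cost g).
  by apply: (@measurable_qs_cost_rec R _ T _ (fun i w => X i w) (fun c _ => pivots g c)) => [i|c].
have mB g : measurable_fun setT (pivot_event g).
  apply: measurable_prod => c _; apply: measurable_b2r.
  exact: (measurableT_comp (f := fun k => k == g c :> nat) _ (measurable_funPT (U c.+1))).
have B0 g w : 0 <= pivot_event g w by exact: prodr_ge0.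
have szK w : size (keys w) = n by rewrite size_map size_enum_ord.
(* Almost surely all positions are valid, and then the run coincides with the run of one table
   [g]. *)
transitivity (\int[P]_w (\sum_g pivot_event g w * pivot_cost g w)%:E)%E.
  apply: ae_eq_integral => //.
  - rewrite /qs_cost; under eq_fun do rewrite szK.
    apply/measurable_EFinP.
    exact: (@measurable_qs_cost_rec R _ T _ (fun i w => X i w) (fun c w => U c w)).
  - by apply/measurable_EFinP; apply: measurable_sum => g; exact: measurable_funM.
  - apply: filterS pivot_valid_ae => w Uw _; congr (_%:E).
    rewrite (sum_pivot_event (F := fun u => (qs_cost_rec n u m (keys w))%:R))//.
      by rewrite /qs_cost szK.
    by move=> u u' uu'; congr (_%:R); apply: qs_cost_rec_ext; rewrite szK.
under eq_integral do rewrite -sumEFin.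
rewrite ge0_integral_sum//; last 2 first.
- by move=> g; apply/measurable_EFinP; exact: measurable_funM.
- by move=> g w _; rewrite lee_fin mulr_ge0.
under eq_bigr do rewrite integral_pivot_cost.
rewrite -ge0_integral_sum//; last 2 first.
- by move=> g; apply/measurable_EFinP; apply: measurable_funM => //; exact: measurable_cst.
- by move=> g w _; rewrite lee_fin mulr_ge0.
under eq_integral do rewrite sumEFin.
apply: ae_eq_integral => //.
- apply/measurable_EFinP; apply: measurable_sum => g; apply: measurable_funM => //; exact: measurable_cst.
- apply/measurable_EFinP; apply: measurable_sum => x.
  under eq_fun do rewrite big_mkcond; apply: measurable_sum => y.
  case: (y != x); last exact: measurable_cst.
  exact: measurable_pair_cost.
(* The mean over tables is known for distinct keys, hence this equality holds only almost
   everywhere. *)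
apply: filterS keys_injective_ae => w vI _; congr (_%:E).
rewrite -[LHS]/(pivot_avg n (fun u => (qs_cost_rec n u m (keys w))%:R)).
rewrite pivot_avg_cost ?szK//; last by rewrite map_inj_uniq// enum_uniq.
by rewrite expected_cost_pattern.
Qed.

Lemma integral_qs_cost_pattern :
  (\int[P]_w ((qs_cost (fun c => U c w) m (keys w))%:R)%:E =
   (n * n.-1)%:R%:E * \int[lebesgue_measure]_(s in `]0%R, 1%R[)
     \int[lebesgue_measure]_(t in `]s, 1%R[) ((beta s t)%:R * pattern_poly n m s t)%:E)%E.
Proof.
set I := (\int[lebesgue_measure]_(s in _) _)%E.
have mp x y : measurable_fun setT (fun w => pair_cost x y (X x w) (X y w) (fun z => X z w)).
  exact: measurable_pair_cost.
rewrite integral_qs_cost.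
transitivity (\int[P]_w (\sum_(q : 'I_n * 'I_n) (if q.2 != q.1 then
    pair_cost q.1 q.2 (X q.1 w) (X q.2 w) (fun z => X z w) else 0)%:E))%E.
  apply: eq_integral => w _; rewrite sumEFin pair_big_dep/= -big_mkcond/=.
  by congr (_%:E); apply: eq_bigl => q.
rewrite ge0_integral_sum//; last 2 first.
- move=> q; apply/measurable_EFinP; case: (q.2 != q.1) => //.
- by move=> q w _; case: ifP => // _; rewrite lee_fin pair_cost_ge0.
(* All [n (n - 1)] ordered pairs of keys contribute the same integral. *)
transitivity (\sum_(q : 'I_n * 'I_n | q.2 != q.1) I)%E.
  rewrite [RHS]big_mkcond; apply: eq_bigr => q _.
  case: ifPn => [qq|_]; last by rewrite integral0.
  by rewrite integral_pair_cost// eq_sym.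
rewrite -(pair_big_dep xpredT (fun x y : 'I_n => y != x) (fun _ _ => I))/=.
have iterE k (z : \bar R) : iter k (adde z) 0%E = (k%:R%:E * z)%E.
  by rewrite mule_natl; elim: k => [|k IH]; rewrite ?mule0n// muleS -IH.
under eq_bigr => x _ do rewrite big_const iterE cardC1 card_ord.
by rewrite big_const iterE card_ord muleA -EFinM -natrM.
Qed.

End ExpectedBitComparisons.

(** * Assembly of the three contributions *)

(** The domain of the inner integral moves with [s]; its series over cells has measurable
    nonnegative terms and settles the question. *)
Lemma measurable_inner_integral (R : realType) q m n :
  measurable_fun (`]0%R, 1%R[ : set (measurableTypeR R)) (fun s : measurableTypeR R =>
  \int[lebesgue_measure]_(t in `]s, 1%R[) ((beta s t)%:R * Pq q m n s t)%:E)%E.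
Proof.
apply: (eq_measurable_fun (fun s : measurableTypeR R => \sum_(0 <= k <oo) (\sum_(l < 2 ^ k)
     (s \in left_half R k l)%:R * (k.+1%:R * Pq_cell_integral q m n k l s))%:E)%E).
  by move=> s; rewrite inE => s01; rewrite inner_integral_series.
apply: ge0_emeasurable_sum => [k s _ _|k _].
  rewrite lee_fin sumr_ge0// => l _.
  case: (boolP (s \in left_half R k l)) => hs; last by rewrite mul0r.
  by rewrite !mulr_ge0// Pq_cell_integral_ge0.
apply/measurable_EFinP/measurable_sum => l.
apply: measurable_funM; first exact: measurable_mem_itv.
by apply: measurable_funM; [exact: measurable_cst|exact: measurable_Pq_cell_integral].
Qed.

Lemma sum_mu_q (R : realType) m n : (1 < n)%N -> (0 < m <= n)%N ->
  ((n * n.-1)%:R%:E * \int[lebesgue_measure]_(s in `]0%R, 1%R[)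
     \int[lebesgue_measure]_(t in `]s, 1%R[) ((beta s t)%:R * pattern_poly n m s t)%:E =
   mu_q R 1 m n + mu_q R 2 m n + mu_q R 3 m n)%E.
Proof.
move=> n2 mn; set c : R := (n * n.-1)%:R.
have c0 : 0 < c by rewrite ltr0n muln_gt0; lia.
pose g q (s : measurableTypeR R) := (\int[lebesgue_measure]_(t in `]s, 1%R[)
  ((beta s t)%:R * Pq q m n s t)%:E)%E.
have bP0 q (s t : R) : s \in `]0, 1[ -> t \in `]s, 1[ ->
    (0 <= ((beta s t)%:R * Pq q m n s t)%:E)%E.
  rewrite !in_itv/= => /andP[s0 s1] /andP[st t1].
  by rewrite lee_fin mulr_ge0// Pq_ge0// ltW.
have mbP q (s : R) : measurable_fun `]s, 1[ (fun t : measurableTypeR R => ((beta s t)%:R * Pq q m n s t)%:E).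
  apply/measurable_EFinP; apply: measurable_funM; last exact: measurable_Pq.
  apply: measurable_funTS.
  exact: (measurableT_comp (@measurable_beta R) (measurable_pair1 s)).
have g0 q s : s \in `]0, 1[ -> (0 <= g q s)%E.
  by move=> s01; apply: integral_ge0 => t /= /(bP0 _ _ _ s01).
have mg q : measurable_fun (`]0%R, 1%R[ : set (measurableTypeR R)) (g q) by exact: measurable_inner_integral.
(* [pattern_poly] is [c^-1] times the sum of the three [Pq]; the factor [c^-1] is pulled out of both
   integrals and cancels [c]. *)
transitivity (c%:E * \int[lebesgue_measure]_(s in `]0%R, 1%R[)
    ((c^-1)%:E * (g 1%N s + g 2%N s + g 3%N s)))%E.
  congr (_ * _)%E; apply: eq_integral => s; rewrite inE/= => s01.
  have h0 q t : (t \in `]s, 1[) -> (0 <= ((beta s t)%:R * Pq q m n s t)%:E)%E by exact: bP0.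
  have m12 := emeasurable_funD (mbP 1%N s) (mbP 2%N s).
  have h12 t : t \in `]s, 1[ -> (0 <= ((beta s t)%:R * Pq 1%N m n s t)%:E +
    ((beta s t)%:R * Pq 2%N m n s t)%:E)%E by move=> tI; rewrite adde_ge0// h0.
  pose f t := (((beta s t)%:R * Pq 1%N m n s t)%:E + ((beta s t)%:R * Pq 2%N m n s t)%:E +
    ((beta s t)%:R * Pq 3%N m n s t)%:E)%E.
  have -> : (g 1%N s + g 2%N s + g 3%N s = \int[lebesgue_measure]_(t in `]s, 1%R[) f t)%E.
    rewrite ge0_integralD//; [|exact: h0|exact: mbP].
    by rewrite ge0_integralD//; [exact: h0|exact: mbP|exact: h0|exact: mbP].
  rewrite -ge0_integralZl ?lee_fin ?invr_ge0 ?(ltW c0)//; last 2 first.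
  - exact: (emeasurable_funD m12 (mbP 3%N s)).
  - by move=> t tI; rewrite /f adde_ge0// (h12, h0).
  apply: eq_integral => t tI.
  rewrite /f -!EFinD -EFinM -!mulrDr -pattern_poly_Pq//.
  by rewrite mulrCA (mulKf (lt0r_neq0 c0)).
have m12 := emeasurable_funD (mg 1%N) (mg 2%N).
have g12 s : s \in `]0, 1[ -> (0 <= g 1%N s + g 2%N s)%E by move=> sI; rewrite adde_ge0// g0.
rewrite ge0_integralZl ?lee_fin ?invr_ge0 ?(ltW c0)//; last 2 first.
- exact: (emeasurable_funD m12 (mg 3%N)).
- by move=> s sI; rewrite adde_ge0// (g12, g0).
rewrite muleA -EFinM divff ?lt0r_neq0// mul1e.
rewrite ge0_integralD//; last by exact: g0.
by rewrite ge0_integralD//; exact: g0.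
Qed.

Theorem mainTheorem4 (R : realType) (d : measure_display) (T : measurableType d)
    (P : probability T R) (n m : nat)
    (X : 'I_n -> {RV P >-> R}) (U : nat -> {RV P >-> nat}) :
  (2 <= n)%N -> (1 <= m <= n)%N ->
  (forall (i : 'I_n) (A : set R), measurable A ->
     distribution P (X i) A = uniform_prob (@ltr01 R) A) ->
  (forall c k : nat, (k < c <= n)%N ->
     P (U c @^-1` [set k]) = (c%:R^-1)%:E) ->
  mutually_independent P (key_pivot_events X U) ->
  'E_P[fun w => (qs_cost (fun c => U c w) m [seq X i w | i : 'I_n])%:R]%E
    = (mu_q R 1 m n + mu_q R 2 m n + mu_q R 3 m n)%E /\
  (forall q : nat, (1 <= q <= 3)%N ->
     mu_q R q m n =
     (\sum_(1 <= a < n) C7 R q m n a * ((1 - 2 ^- a) ^- 2))%:E).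
Proof.
move=> n2 mn unifX unifU indep; split=> [|q _]; last exact: mu_q_closed_form.
rewrite unlock -sum_mu_q//.
exact: (integral_qs_cost_pattern n2 mn unifX unifU indep).
Qed.
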